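(* Let $P=\{p<q\}$ and let $W=(X, X\to P)\in\mathrm{Sam}_P$ be a compact Lojasiewicz-Whitney stratified space which is $\Phi$-stratified with respect to a continuous function $\Phi:\mathrm{Sam}_\star\to[0,1]$. Then there exists $u_0\in(0,1)$ such that for all $u\in[u_0,1)$ the following holds: for every sequence $\zeta_n\in(0,\infty)$ with $\zeta_n\to\infty$ and every sequence $\mathbb X_n\in\mathrm{Sam}$ with $\zeta_n\, d_{\mathrm{Hd}}(\mathbb X_n,X)\to 0$, one has $$\mathcal S^{u}_{\zeta_n,\Phi}(\mathbb X_n)\longrightarrow W \quad\text{in } \mathrm{Sam}_P .$$
   Context: Fix $\mathbb R^N$ with Euclidean norm $\|\cdot\|$. ''Metric'' means symmetric Lawvere metric (value $\infty$ allowed, distinct points may have distance $0$). For $\mathbb X\subset\mathbb R^N$, $\alpha\ge0$: $\mathbb X_\alpha=\{y\mid \exists x\in\mathbb X:\|x-y\|\le\alpha\}$. $\mathrm{Sam}$ is the set of all subsets of $\mathbb R^N$ with the Hausdorff distance $d_{\mathrm{Hd}}(\mathbb X,\mathbb X')=\inf\{\alpha>0\mid \mathbb X\subset\mathbb X'_\alpha,\ \mathbb X'\subset\mathbb X_\alpha\}$. $\mathrm{Sam}_P$ is the set of pairs $(\mathbb X,\mathbb X_p)$, $\mathbb X_p\subset\mathbb X\subset\mathbb R^N$, with metric $\max\{d_{\mathrm{Hd}}(\mathbb X,\mathbb X'),d_{\mathrm{Hd}}(\mathbb X_p,\mathbb X'_p)\}$ (stratified Hausdorff distance). $\mathrm{Sam}_\star$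 is the set of all subsets of $\mathbb R^N$ with metric $d_{\mathrm{Sam}_\star}(\mathbb B,\mathbb B')=d_{\mathrm{Hd}}(\mathbb B\cap B_1(0),\mathbb B'\cap B_1(0))$, where $B_r(x)$ is the closed ball. Stratified spaces: a stratified space over $P=\{p<q\}$ is a space $X$ with a map $s:X\to P$ continuous for the Alexandrov topology (down-closed sets are closed), i.e. $W_p=s^{-1}(p)$ is closed in $X$; $W_q=s^{-1}(q)$. If $X\subset\mathbb R^N$, it is viewed as the element $(X,W_p)$ of $\mathrm{Sam}_P$. $W=(X,s)$ with $X\subset\mathbb R^N$ locally closed is Whitney stratified if: $W_q$ is dense in $X$; $W_p,W_q$ are smooth submanifolds of $\mathbb R^N$; and (condition (b)) for sequences $x_n\in W_q$, $y_n\in W_p$ both converging to some $y\in W_p$ such that the secants $l(x_n,y_n)=\mathrm{span}(x_n-y_n)$ converge to a line $l$ and the tangent spaces $T_{x_n}W_q$ converge to $\tau$, one has $l\subset\tau$. The same symbol $q$ denotes the dimension of $W$ (i.e. of $W_q$). For linear subspaces $V,U$ let $\vec d(V,U)=\sup_{v\in V,\|v\|=1}\inf_{u\in U}\|v-u\|$. Set $\beta(x,y)=\vec d(l(x,y),T_xW_{s(x)})$ for $x\ne y$ in $X$, and $\beta(x,x)=0$. A Whitney stratified $W$ is Lojasiewicz-Whitney stratified if for every compact $K$ contained in a single stratum there are $\alpha>0,d_0>0$ such that $\beta(x,y)\le\|y-x\|^\alpha$ for all $y\in K$, $x\in X\cap B_{d_0}(y)$. Magnifications: for $\mathbb X\subset\mathbb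 R^N$, $x\in\mathbb R^N$, $\zeta>0$: $\mathcal M^\zeta_x(\mathbb X)=\zeta(\mathbb X-x)\cap B_1(0)\in\mathrm{Sam}_\star$. Extrinsic tangent cone at $x\in X$: $T^{ex}_x(X)=\{v\in\mathbb R^N\mid\forall\varepsilon>0\ \exists y\in B_\varepsilon(x)\cap X: v\in(\mathbb R_{\ge0}(y-x))_\varepsilon\}\in\mathrm{Sam}_\star$. Let $\Phi:\mathrm{Sam}_\star\to[0,1]$ be continuous with $\Phi(V)=1$ whenever $V$ is a $q$-dimensional linear subspace of $\mathbb R^N$. A $q$-dimensional Whitney stratified space $W$ is $\Phi$-stratified if $\Phi(T^{ex}_x(X))<1$ for all $x\in W_p$. For $\zeta>0$, $u\in[0,1)$ and $\mathbb X\in\mathrm{Sam}$: $\mathcal S^u_{\zeta,\Phi}(\mathbb X)=(\mathbb X,\{x\in\mathbb X\mid \Phi(\mathcal M^\zeta_x(\mathbb X))\le u\})\in\mathrm{Sam}_P$. *)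

(* Defs.v *)
(* MathComp-Analysis *)
From HB Require Import structures.
From mathcomp Require Import all_boot all_order all_algebra.
From mathcomp Require Import all_classical all_reals all_analysis.

Set Implicit Arguments.
Unset Strict Implicit.
Unset Printing Implicit Defensive.

Import Order.TTheory GRing.Theory Num.Theory.
Import numFieldNormedType.Exports.

Local Open Scope classical_set_scope.
Local Open Scope ring_scope.

(* The canonical norm of 'rV[R]_N is the sup norm, hence a separate Euclidean
   norm. Both induce the same topology, so closedness, compactness and
   convergence of points are those of 'rV[R]_N. *)
Definition enorm (R : realType) (N : nat) (v : 'rV[R]_N) : R :=
  Num.sqrt (\sum_(i < N) v 0 i ^+ 2).

Definition eball (R : realType) (N : nat) (x : 'rV[R]_N) (r : R) :
    set 'rV[R]_N :=
  [set y : 'rV[R]_N | enorm (y - x) <= r].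

Definition thickening (R : realType) (N : nat) (X : set 'rV[R]_N) (a : R) :
    set 'rV[R]_N :=
  [set y : 'rV[R]_N | exists2 x, X x & enorm (x - y) <= a].

(* The infimum of the empty set is +oo. *)
Definition dHd (R : realType) (N : nat) (X X' : set 'rV[R]_N) : \bar R :=
  ereal_inf [set a%:E | a in
    [set a : R | [/\ 0 < a, X `<=` thickening X' a & X' `<=` thickening X a]]].

Record SamP (R : realType) (N : nat) := MkSamP {
  samP_total : set 'rV[R]_N ;
  samP_p : set 'rV[R]_N ;
  samP_sub : samP_p `<=` samP_total }.

Definition dSamP (R : realType) (N : nat) (S S' : SamP R N) : \bar R :=
  Order.max (dHd (samP_total S) (samP_total S')) (dHd (samP_p S) (samP_p S')).

Definition dSamStar (R : realType) (N : nat) (B B' : set 'rV[R]_N) : \bar R :=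
  dHd (B `&` eball 0 1) (B' `&` eball 0 1).

Definition samstar_continuous (R : realType) (N : nat)
    (Phi : set 'rV[R]_N -> R) : Prop :=
  forall (B : set 'rV[R]_N) (e : R), 0 < e ->
    exists2 d : R, 0 < d &
      forall B' : set 'rV[R]_N,
        (dSamStar B B' < d%:E)%E -> `|Phi B - Phi B'| < e.

(* The poset P = {p < q} is bool with false < true: p is false, q is true.
   A map s : X -> P is given by a total function of which only the values
   on X are used. *)
Definition stratum (R : realType) (N : nat) (X : set 'rV[R]_N)
    (s : 'rV[R]_N -> bool) (i : bool) : set 'rV[R]_N :=
  X `&` s @^-1` [set i].

(* Continuity of s : X -> P: preimages of down-closed sets are closed in X. *)
Definition stratified (R : realType) (N : nat) (X : set 'rV[R]_N)
    (s : 'rV[R]_N -> bool) : Prop :=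
  forall D : set bool, (forall i j : bool, (i <= j)%O -> D j -> D i) ->
    exists2 C : set 'rV[R]_N, closed C & X `&` s @^-1` D = X `&` C.

Definition samP_of_strat (R : realType) (N : nat) (X : set 'rV[R]_N)
    (s : 'rV[R]_N -> bool) : SamP R N :=
  @MkSamP R N X (stratum X s false) (@subIsetl _ _ _).

Definition locally_closed (T : topologicalType) (X : set T) : Prop :=
  exists U C : set T, [/\ open U, closed C & X = U `&` C].

(* C^k on an open set U, through iterated directional derivatives. *)
Fixpoint Ck_on (R : realType) (V W : normedModType R) (k : nat)
    (U : set V) (f : V -> W) : Prop :=
  (forall x, U x -> {for x, continuous f}) /\
  (if k is k'.+1 then
     forall v : V, (forall x, U x -> derivable f x v) /\
                   Ck_on k' U (fun x => 'D_v f x)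
   else True).

Definition smooth_on (R : realType) (V W : normedModType R)
    (U : set V) (f : V -> W) : Prop :=
  forall k : nat, Ck_on k U f.

(* Near x there is a diffeomorphism between open subsets of R^N that
   straightens M to R^k x {0}. *)
Definition submanifold_at (R : realType) (N k : nat) (M : set 'rV[R]_N)
    (x : 'rV[R]_N) : Prop :=
  (k <= N)%N /\
  exists (U : set 'rV[R]_N) (f g : 'rV[R]_N -> 'rV[R]_N),
    [/\ open U /\ U x,
        open (f @` U),
        smooth_on U f /\ smooth_on (f @` U) g,
        (forall y, U y -> g (f y) = y) &
        f @` (U `&` M) =
          (f @` U) `&`
          [set z : 'rV[R]_N | forall i : 'I_N, (k <= i)%N -> z 0 i = 0]].

Definition submanifold_dim (R : realType) (N k : nat) (M : set 'rV[R]_N) :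
    Prop :=
  forall x, M x -> submanifold_at k M x.

(* The dimension is allowed to depend on the connected component. *)
Definition submanifold (R : realType) (N : nat) (M : set 'rV[R]_N) : Prop :=
  forall x, M x -> exists k : nat, submanifold_at k M x.

(* Velocities at x of smooth curves in M. *)
Definition tangent_space (R : realType) (N : nat) (M : set 'rV[R]_N)
    (x : 'rV[R]_N) : set 'rV[R]_N :=
  [set v : 'rV[R]_N | exists (e : R) (c : R -> 'rV[R]_N),
     [/\ 0 < e,
         smooth_on (ball (0 : R^o) e) (c : R^o -> 'rV[R]_N),
         (forall t : R, `|t| < e -> M (c t)),
         c 0 = x &
         derive1 c 0 = v]].

(* sup_{v in V, |v| = 1} inf_{u in U} |v - u|, equal to 0 for V = 0. Linear
   subspaces enter as sets of vectors, so that tangent spaces are covered. *)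
Definition dvec (R : realType) (N : nat) (V U : set 'rV[R]_N) : R :=
  sup [set inf [set enorm (v - u) | u in U] | v in
         [set v : 'rV[R]_N | V v /\ enorm v = 1]].

Definition secant (R : realType) (N : nat) (x y : 'rV[R]_N) : set 'rV[R]_N :=
  [set v : 'rV[R]_N | v \in <[x - y]>%VS].

(* Convergence in the Grassmannian: the gap max(dvec V U, dvec U V) metrizes
   its topology, and gap < 1 forces equal dimensions. *)
Definition subspace_cvg (R : realType) (N : nat) (V : nat -> set 'rV[R]_N)
    (L : {vspace 'rV[R]_N}) : Prop :=
  (fun n => Num.max (dvec (V n) [set v : 'rV[R]_N | v \in L])
                    (dvec [set v : 'rV[R]_N | v \in L] (V n)))
    @ \oo --> (0 : R).

Definition condition_b (R : realType) (N : nat) (X : set 'rV[R]_N)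
    (s : 'rV[R]_N -> bool) : Prop :=
  forall (x y : nat -> 'rV[R]_N) (z : 'rV[R]_N) (l tau : {vspace 'rV[R]_N}),
    (forall n, stratum X s true (x n)) ->
    (forall n, stratum X s false (y n)) ->
    stratum X s false z ->
    x @ \oo --> z ->
    y @ \oo --> z ->
    \dim l = 1%N ->
    subspace_cvg (fun n => secant (x n) (y n)) l ->
    subspace_cvg (fun n => tangent_space (stratum X s true) (x n)) tau ->
    (l <= tau)%VS.

Definition whitney_stratified (R : realType) (N q : nat) (X : set 'rV[R]_N)
    (s : 'rV[R]_N -> bool) : Prop :=
  [/\ stratified X s,
      locally_closed X,
      X `<=` closure (stratum X s true),
      submanifold (stratum X s false) /\ submanifold_dim q (stratum X s true) &
      condition_b X s].

Definition lw_beta (R : realType) (N : nat) (X : set 'rV[R]_N)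
    (s : 'rV[R]_N -> bool) (x y : 'rV[R]_N) : R :=
  if x == y then 0
  else dvec (secant x y) (tangent_space (stratum X s (s x)) x).

Definition lojasiewicz_whitney (R : realType) (N q : nat) (X : set 'rV[R]_N)
    (s : 'rV[R]_N -> bool) : Prop :=
  whitney_stratified q X s /\
  forall (K : set 'rV[R]_N) (i : bool), compact K -> K `<=` stratum X s i ->
    exists alpha d0 : R, [/\ 0 < alpha, 0 < d0 &
      forall x y : 'rV[R]_N, K y -> X x -> eball y d0 x ->
        lw_beta X s x y <= enorm (y - x) `^ alpha].

Definition magnification (R : realType) (N : nat) (zeta : R)
    (x : 'rV[R]_N) (X : set 'rV[R]_N) : set 'rV[R]_N :=
  [set zeta *: (y - x) | y in X] `&` eball 0 1.

Definition ext_tangent_cone (R : realType) (N : nat) (X : set 'rV[R]_N)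
    (x : 'rV[R]_N) : set 'rV[R]_N :=
  [set v : 'rV[R]_N | forall e : R, 0 < e -> exists y : 'rV[R]_N,
     [/\ eball x e y, X y &
         thickening [set t *: (y - x) | t in [set t : R | 0 <= t]] e v]].

Definition Phi_stratified (R : realType) (N : nat) (Phi : set 'rV[R]_N -> R)
    (X : set 'rV[R]_N) (s : 'rV[R]_N -> bool) : Prop :=
  forall x, stratum X s false x -> Phi (ext_tangent_cone X x) < 1.

Definition Phi_stratification (R : realType) (N : nat) (Phi : set 'rV[R]_N -> R)
    (u zeta : R) (X : set 'rV[R]_N) : SamP R N :=
  @MkSamP R N X (X `&` [set x : 'rV[R]_N | Phi (magnification zeta x X) <= u])
    (@subIsetl _ _ _).

(* Main.v *)
Require Import Defs.
From HB Require Import structures.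
From mathcomp Require Import all_boot all_order all_algebra.
From mathcomp Require Import all_classical all_reals all_analysis.
From mathcomp Require Import ring lra.

Set Implicit Arguments.
Unset Strict Implicit.
Unset Printing Implicit Defensive.

Import Order.TTheory GRing.Theory Num.Theory.
Import numFieldNormedType.Exports.

Local Open Scope classical_set_scope.
Local Open Scope ring_scope.

(** Every tangent cone of X is approached by magnifications of X, uniformly near
    each point of a compact subset K of one stratum, and the approximation
    tolerates errors in the base point and in X that are small after
    magnification ([magnification_near_cone]). Granted this, continuity of Phi
    and compactness give uniform bounds ([Phi_magnification_uniform]). For K the
    closed stratum W_p, where Phi of the tangent cone is smaller than 1, there is
    u0 < 1 such that the stratification at level u >= u0 eventually contains
    points close to every point of W_p. For K the set of points of X at distance
    at least e / 2 from W_p, where the tangent cone is a q-dimensional subspace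
    ([ext_tangent_cone_submanifold]) and Phi takes the value 1, it eventually
    contains no point at distance more than e from W_p.

    The geometric input is that X is nearly conic at the points p of K: the
    directions in which X is seen from p at small scales are almost independent
    of the scale, uniformly in p ([lojasiewicz_uniformly_conic]). Classically one
    integrates on each stratum the projection of the radial vector field of p:
    at distance r from p it is radial up to an error r^a, and the turning of a
    trajectory is bounded by the integral of r^a / r, which converges at 0. Here
    no flow is integrated. At every point of X there is a short nearly radial
    step inside X ([radial_step]), whose turning is dominated by the variation
    of r^a ([powR_gauge]); since X is compact, a point that comes closest to a
    prescribed radius while paying for its turning with r^a must be at that
    radius ([radial_flow]). In this form, trajectories may pass from one stratum
    to the other.

    Conicity suffices to compare magnifications with tangent cones. A direction
    seen from p at a small scale is also seen at a fixed scale; there the base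
    point can be moved to a nearby point y of K with little effect, and the
    direction is then followed back to scale zero at y. In this way truncation
    by the unit ball does no harm, although truncation is not continuous for the
    Hausdorff distance of general sets. *)

(** * The Euclidean norm *)

Section EuclideanNorm.
Context {R : realType} {N : nat}.
Implicit Types p u v w x y : 'rV[R]_N.

Lemma enorm_ge0 v : 0 <= enorm v.
Proof. exact: sqrtr_ge0. Qed.

Lemma sqr_enorm v : enorm v ^+ 2 = \sum_(i < N) v 0 i ^+ 2.
Proof. by rewrite sqr_sqrtr// sumr_ge0// => i _; exact: sqr_ge0. Qed.

Lemma coord_le_enorm v i : `|v 0 i| <= enorm v.
Proof.
rewrite -(@ler_pXn2r _ 2)// ?nnegrE ?enorm_ge0// sqr_enorm real_normK ?num_real//.
by rewrite (bigD1 i)//= lerDl sumr_ge0// => j _; exact: sqr_ge0.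
Qed.

Lemma normr_le_enorm v : `|v| <= enorm v.
Proof.
rewrite [leLHS]/Num.Def.normr/= mx_normrE.
apply: bigmax_le; first exact: enorm_ge0.
by move=> [i j] _ /=; rewrite ord1; exact: coord_le_enorm.
Qed.

Lemma coord_le_normr v i : `|v 0 i| <= `|v|.
Proof.
by rewrite [leRHS]/Num.Def.normr/= mx_normrE; exact: (le_bigmax _ _ (0, i)).
Qed.

Lemma enorm0 : enorm (0 : 'rV[R]_N) = 0.
Proof. by rewrite /enorm big1 ?sqrtr0// => i _; rewrite mxE expr0n. Qed.

Lemma enorm_eq0 v : (enorm v == 0) = (v == 0).
Proof.
apply/eqP/eqP => [v0|->]; last exact: enorm0.
apply/rowP => i; rewrite mxE; apply/eqP; rewrite -normr_le0 -v0.
exact: coord_le_enorm.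
Qed.

Lemma enorm_gt0 v : (0 < enorm v) = (v != 0).
Proof. by rewrite lt_def enorm_ge0 enorm_eq0 andbT. Qed.

Lemma enormZ (a : R) v : enorm (a *: v) = `|a| * enorm v.
Proof.
rewrite /enorm -sqrtr_sqr -sqrtrM ?sqr_ge0// mulr_sumr; congr Num.sqrt.
by apply: eq_bigr => i _; rewrite mxE exprMn.
Qed.

Lemma enormN v : enorm (- v) = enorm v.
Proof. by rewrite -scaleN1r enormZ normrN1 mul1r. Qed.

Lemma enormB v w : enorm (v - w) = enorm (w - v).
Proof. by rewrite -enormN opprB. Qed.

(** Cauchy-Schwarz, by averaging the inequalities 2ab <= a^2 + b^2 for the
    coordinates of the normalised vectors. *)
Lemma enorm_cauchy_schwarz v w :
  \sum_(i < N) v 0 i * w 0 i <= enorm v * enorm w.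
Proof.
have [->|v0] := eqVneq v 0.
  by rewrite enorm0 mul0r big1// => i _; rewrite mxE mul0r.
have [->|w0] := eqVneq w 0.
  by rewrite enorm0 mulr0 big1// => i _; rewrite mxE mulr0.
move: v0 w0; rewrite -!enorm_gt0 => v0 w0.
suff: 2 * (\sum_(i < N) v 0 i * w 0 i) * (enorm v * enorm w) <=
      2 * (enorm v * enorm w) * (enorm v * enorm w).
  by rewrite ler_pM2r ?mulr_gt0// ler_pM2l.
have -> : 2 * (enorm v * enorm w) * (enorm v * enorm w) =
    \sum_(i < N) (enorm w ^+ 2 * v 0 i ^+ 2 + enorm v ^+ 2 * w 0 i ^+ 2).
  by rewrite big_split/= -!mulr_sumr -!sqr_enorm; ring.
rewrite mulr_sumr mulr_suml ler_sum// => i _.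
rewrite -subr_ge0.
have -> : enorm w ^+ 2 * v 0 i ^+ 2 + enorm v ^+ 2 * w 0 i ^+ 2 -
  2 * (v 0 i * w 0 i) * (enorm v * enorm w) =
  (enorm w * v 0 i - enorm v * w 0 i) ^+ 2 by ring.
exact: sqr_ge0.
Qed.

Lemma enormD v w : enorm (v + w) <= enorm v + enorm w.
Proof.
rewrite -(@ler_pXn2r _ 2)// ?nnegrE ?addr_ge0 ?enorm_ge0//.
rewrite sqrrD !sqr_enorm.
under eq_bigr do rewrite mxE sqrrD.
rewrite !big_split/= lerD2r lerD2l mulr2n.
by rewrite lerD// enorm_cauchy_schwarz.
Qed.

Lemma enorm_triangle x y z : enorm (x - z) <= enorm (x - y) + enorm (y - z).
Proof. by rewrite -[x - z](subrKA y) enormD. Qed.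

Lemma enorm_dist v w : `|enorm v - enorm w| <= enorm (v - w).
Proof.
rewrite ler_norml lerBlDr lerNl opprB lerBlDr.
apply/andP; split.
- by have := enormD (w - v) v; rewrite subrK enormB.
- by have := enormD (v - w) w; rewrite subrK.
Qed.

Lemma enorm_le_normr v : enorm v <= N%:R * `|v|.
Proof.
have delta1 i : enorm (delta_mx 0 i : 'rV[R]_N) = 1.
  rewrite /enorm (bigD1 i)//= big1 ?addr0 => [|j /negbTE ji].
    by rewrite mxE !eqxx expr1n sqrtr1.
  by rewrite mxE eqxx ji expr0n.
apply: (@le_trans _ _ (\sum_(i < N) `|v 0 i|)).
  rewrite [in leLHS](row_sum_delta v).
  elim/big_ind2 : _ => [|a b c d ab cd|i _]; first by rewrite enorm0.
    by rewrite (le_trans (enormD _ _))// lerD.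
  by rewrite enormZ delta1 mulr1.
apply: (@le_trans _ _ (\sum_(i < N) `|v|)).
  by rewrite ler_sum// => i _; exact: coord_le_normr.
by rewrite sumr_const card_ord mulr_natl.
Qed.

Lemma nbhs_enorm x (A : set 'rV[R]_N) :
  nbhs x A <-> exists2 e : R, 0 < e & forall y, enorm (y - x) < e -> A y.
Proof.
split=> [/(@nbhs_ballP _ 'rV[R]_N)[e /= e0 eA]|[e e0 eA]].
  exists e => // y yx; apply: eA; rewrite -ball_normE /=.
  by rewrite distrC (le_lt_trans (normr_le_enorm _)).
apply/(@nbhs_ballP _ 'rV[R]_N); exists (e / N.+1%:R) => [|y].
  by rewrite /= divr_gt0.
rewrite -ball_normE /=.
rewrite ltr_pdivlMr// => h; apply: eA; rewrite enormB.
rewrite (le_lt_trans (enorm_le_normr _))// (le_lt_trans _ h)// mulrC ler_wpM2l//.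
by rewrite ler_nat.
Qed.

Lemma continuous_lipschitz_at (f : 'rV[R]_N -> R) x (C : R) : 0 < C ->
  (forall y, `|f y - f x| <= C * enorm (y - x)) -> {for x, continuous f}.
Proof.
move=> C0 fC A /nbhs_ballP[e /= e0 eA]; apply/nbhs_enorm.
exists (e / C) => [|y]; first by rewrite divr_gt0.
rewrite ltr_pdivlMr// => yx; apply: eA; rewrite /ball/= distrC.
by rewrite (le_lt_trans (fC y))// mulrC.
Qed.

Lemma enorm_sub_continuous p : continuous (fun y => enorm (y - p)).
Proof.
move=> x; apply: (@continuous_lipschitz_at _ _ 1) => // y.
by rewrite mul1r (le_trans (enorm_dist _ _))// opprB addrA subrK.
Qed.

(** ** Unit directions *)

(** The direction of 0 is 0. *)
Definition dir v : 'rV[R]_N := (enorm v)^-1 *: v.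

Lemma enorm_dir v : v != 0 -> enorm (dir v) = 1.
Proof.
move=> v0; rewrite enormZ ger0_norm ?invr_ge0 ?enorm_ge0//.
by rewrite mulVf// enorm_eq0.
Qed.

Lemma enorm_dir_le1 v : enorm (dir v) <= 1.
Proof.
have [->|v0] := eqVneq v 0; first by rewrite /dir scaler0 enorm0.
by rewrite enorm_dir.
Qed.

Lemma scale_dir v : enorm v *: dir v = v.
Proof.
have [->|v0] := eqVneq v 0; first by rewrite /dir !scaler0.
by rewrite /dir scalerA divff ?scale1r// enorm_eq0.
Qed.

Lemma dirZ (a : R) v : 0 < a -> dir (a *: v) = dir v.
Proof.
move=> a0; rewrite /dir enormZ gtr0_norm// scalerA invfM mulrAC mulVf ?mul1r//.
by rewrite gt_eqF.
Qed.

Lemma dir_unit v : enorm v = 1 -> dir v = v.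
Proof. by rewrite /dir => ->; rewrite invr1 scale1r. Qed.

Lemma dir_lipschitz v w : w != 0 ->
  enorm (dir v - dir w) <= 2 * enorm (v - w) / enorm w.
Proof.
rewrite -enorm_gt0 => w0; rewrite ler_pdivlMr//.
have -> : enorm (dir v - dir w) * enorm w =
    enorm ((enorm w - enorm v) *: dir v + (v - w)).
  rewrite -[LHS]mulrC -{1}(ger0_norm (enorm_ge0 w)) -enormZ; congr enorm.
  by rewrite scalerBr scale_dir scalerBl scale_dir subrKA.
rewrite (le_trans (enormD _ _))// mulr_natl mulr2n lerD2r enormZ.
rewrite (le_trans (ler_piMr _ (enorm_dir_le1 _)))//.
by rewrite distrC enorm_dist.
Qed.

End EuclideanNorm.

(** * Moving radially along a Lojasiewicz-Whitney space *)

(** First-order approximation is all that is used of smooth curves in a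
    stratum; the parameter t takes both signs. *)
Definition first_order_tangent (R : realType) (N : nat) (X : set 'rV[R]_N)
    (x w : 'rV[R]_N) : Prop :=
  forall e : R, 0 < e -> exists2 d : R, 0 < d &
    forall t : R, `|t| < d ->
      exists2 x', X x' & enorm (x' - (x + t *: w)) <= e * `|t|.

Section RadialFlow.
Context {R : realType} {N : nat}.
Implicit Types (X M : set 'rV[R]_N) (p v w x y : 'rV[R]_N).

Lemma tangent_space_first_order M x v :
  tangent_space M x v -> first_order_tangent M x v.
Proof.
move=> [e [c [e0 smc Mc c0 cv]]] eps eps0.
have [_ /(_ 1)[/(_ 0) dc _]] := smc 1%N.
have {}dc : derivable c 0 1 by apply: dc; exact: ballxx.
move: cv; rewrite derive1E => cv.
have : nbhs v [set y | enorm (y - v) < eps].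
  by apply/nbhs_enorm; exists eps.
rewrite -{1}cv => /dc /nbhs_ballP[d /= d0 dP].
exists (Num.min d e) => [|t]; first by rewrite lt_min d0.
rewrite lt_min => /andP[td te].
exists (c t); first exact: Mc.
have [->|t0] := eqVneq t 0.
  by rewrite c0 scale0r addr0 subrr enorm0 normr0 mulr0.
have := dP t; rewrite /ball/= sub0r normrN => /(_ td t0).
rewrite addr0 c0 => /ltW; rewrite -[_ *: 1]/(t * 1) mulr1 => h.
have -> : c t - (x + t *: v) = t *: (t^-1 *: (c t - x) - v).
  by rewrite scalerBr scalerA divff// scale1r opprD addrA.
by rewrite enormZ mulrC ler_wpM2r.
Qed.

(** The infimum in dvec need not be attained, hence the strict bound. *)
Lemma dvec_lt_approx (V U : set 'rV[R]_N) v (c : R) :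
    V v -> enorm v = 1 -> U 0 -> dvec V U < c ->
  exists2 u, U u & enorm (v - u) < c.
Proof.
move=> Vv v1 U0 VUc; apply: contrapT => far.
have infle w : inf [set enorm (w - u) | u in U] <= enorm w.
  apply: ge_inf; last by exists 0; rewrite ?subr0.
  by exists 0 => _ [u _ <-]; exact: enorm_ge0.
suff : c <= dvec V U by rewrite leNgt VUc.
apply: (@le_trans _ _ (inf [set enorm (v - u) | u in U])).
  apply: lb_le_inf; first by exists (enorm (v - 0)), 0.
  move=> _ [u Uu <-]; rewrite leNgt; apply/negP => uc.
  by apply: far; exists u.
apply: sup_ubound; last by exists v.
by exists 1 => _ [w [_ w1] <-]; rewrite -w1.
Qed.

(** The concave function s^a lies below its tangent at 1: this is Young's
    inequality with the exponents 1 / a and 1 / (1 - a). *)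
Lemma powR_le_linear (a s : R) : 0 < a < 1 -> 0 <= s -> s `^ a <= a * s + 1 - a.
Proof.
move=> /andP[a0 a1] s0.
have := @conjugate_powR R (s `^ a) 1 a^-1 (1 - a)^-1 (powR_ge0 _ _) ler01.
rewrite !invr_gt0 subr_gt0 !invrK mulr1 powR1 mul1r -powRrM divff ?gt_eqF//.
rewrite powRr1// => h.
have : s `^ a <= s * a + (1 - a) by apply: h; rewrite // subrKC.
by lra.
Qed.

(** A direction changes by O(r^a |s - r| / r) along a step from radius r to
    radius s whose angular error is O(r^a). The variation of r^a pays for this:
    it is the integrability of r^a / r at 0. *)
Lemma powR_gauge (a r s : R) : 0 < a < 1 -> 0 < r -> 0 < s -> s <= 2 * r ->
  a / 2 * r `^ a * (`|s - r| / r) <= `|s `^ a - r `^ a|.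
Proof.
move=> a01 r0 s0 sr; have /andP[a0 a1] := a01.
pose k := s / r; have k0 : 0 < k by rewrite divr_gt0.
have k2 : k <= 2 by rewrite ler_pdivrMr.
have sE : s = k * r by rewrite divfK ?gt_eqF.
have -> : s - r = (k - 1) * r by rewrite sE mulrBl mul1r.
have -> : s `^ a - r `^ a = (k `^ a - 1) * r `^ a.
  by rewrite sE powRM ?ltW// mulrBl mul1r.
rewrite !normrM [`|r|]gtr0_norm// mulfK ?gt_eqF//.
rewrite [`|r `^ a|]ger0_norm ?powR_ge0//.
rewrite mulrAC ler_wpM2r ?powR_ge0//.
have [k1|k1] := leP k 1.
  have h := powR_le_linear a01 (ltW k0).
  have ak : 0 <= a * (1 - k) by rewrite mulr_ge0 ?subr_ge0// ltW.
  have ka1 : k `^ a - 1 <= 0 by lra.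
  have k10 : k - 1 <= 0 by lra.
  by rewrite (ler0_norm ka1) (ler0_norm k10); nra.
have ka1 : 1 <= k `^ a.
  have := @ge0_ler_powR _ a (ltW a0) 1 k.
  by rewrite powR1 !nnegrE => ->//; rewrite ?ltW.
have kV0 : 0 < k^-1 by rewrite invr_gt0.
have h := powR_le_linear a01 (ltW kV0).
have ka : k^-1 `^ a * k `^ a = 1.
  by rewrite -powRM ?ltW// mulVf ?gt_eqF// powR1.
have kk : k * k^-1 = 1 by rewrite divff ?gt_eqF.
have k10 : 0 <= k - 1 by lra.
have ka10 : 0 <= k `^ a - 1 by lra.
rewrite (ger0_norm k10) (ger0_norm ka10).
have kVh : 1 / 2 <= k^-1 by rewrite mul1r lef_pV2 ?posrE.
have h1 : k^-1 `^ a * k `^ a <= (a * k^-1 + 1 - a) * k `^ a.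
  by rewrite ler_wpM2r ?powR_ge0.
have h2 : a * (k - 1) * (1 / 2) <= a * (k - 1) * k^-1.
  by rewrite ler_wpM2l// mulr_ge0// ltW.
have h3 : 0 <= a * (1 - k^-1) * (k `^ a - 1).
  by rewrite !mulr_ge0 ?subr_ge0 ?invf_le1 ?(ltW a0) ?(ltW k1).
nra.
Qed.

(** As w is h-close to the radial direction, a step t along w changes the radius
    by t up to O(h |t|), and turns by O(h |t| / r) as seen from p. *)
Lemma radial_step X p x w (h : R) : x != p -> first_order_tangent X x w ->
    0 < h <= 1 / 4 -> enorm (dir (x - p) - w) <= h ->
  exists2 d : R, 0 < d & forall t : R, `|t| < d -> exists2 x', X x' &
    `|enorm (x' - p) - (enorm (x - p) + t)| <= `|t| / 2 /\
    enorm (dir (x' - p) - dir (x - p)) <= 8 * h * (`|t| / enorm (x - p)).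
Proof.
move=> xp Xw /andP[h0 h4] wh.
have r0 : 0 < enorm (x - p) by rewrite enorm_gt0 subr_eq0.
set r := enorm (x - p) in r0 *.
have [d d0 dX] := Xw _ h0.
exists (Num.min d (r / 2)) => [|t]; first by rewrite lt_min d0 divr_gt0.
rewrite lt_min => /andP[td tr].
have [x' Xx' x'P] := dX t td; exists x' => //.
have k0 : 1 / 2 <= 1 + t / r.
  move: tr; rewrite ltr_norml => /andP[tr _].
  suff : - (1 / 2) <= t / r by lra.
  by rewrite ler_pdivlMr//; lra.
set k := 1 + t / r in k0.
have kr : enorm (k *: (x - p)) = r + t.
  rewrite enormZ ger0_norm ?(le_trans _ k0)// mulrDl mul1r divfK//.
  by rewrite gt_eqF.
have dev : enorm ((x' - p) - k *: (x - p)) <= 2 * h * `|t|.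
  have -> : (x' - p) - k *: (x - p) =
      (x' - (x + t *: w)) - t *: (dir (x - p) - w).
    rewrite /k scalerDl scale1r -scalerA -/(dir _) scalerBr !opprD !opprK.
    rewrite [- x + p]addrC !addrA subrK -!addrA; congr (_ + (_ + _)).
    by rewrite addrCA addNr addr0.
  rewrite (le_trans (enormD _ _))// enormN enormZ.
  rewrite mulr2n !mulrDl mul1r lerD// mulrC ler_wpM2r//.
have ht : 2 * h * `|t| <= `|t| / 2.
  by rewrite [_ / 2]mulrC ler_wpM2r//; lra.
split; first by rewrite -kr (le_trans (enorm_dist _ _))// (le_trans dev).
have kgt0 : 0 < k by lra.
rewrite -(dirZ (x - p) kgt0) (le_trans (dir_lipschitz _ _))//.
  by rewrite scaler_eq0 gt_eqF//= subr_eq0.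
have rt : r / 2 <= r + t.
  by move: tr; rewrite ltr_norml => /andP[tr _]; lra.
rewrite kr ler_pdivrMr; last by lra.
apply: (@le_trans _ _ (4 * h * `|t|)); first by lra.
have -> : 4 * h * `|t| = 8 * h * (`|t| / r) * (r / 2).
  by field; rewrite gt_eqF.
by rewrite ler_wpM2l// !mulr_ge0 ?invr_ge0 ?(ltW h0) ?(ltW r0).
Qed.

End RadialFlow.

Lemma closed_sublevel (R : realType) (T : topologicalType) (A : set T)
    (f : T -> R) (c : R) :
  closed A -> (forall x, A x -> {for x, continuous f}) ->
  closed (A `&` [set x | f x <= c]).
Proof.
move=> cA cf x clx.
have Ax : A x by apply: cA => U /clx[y [[Ay _] Uy]]; exists y.
split=> //=; rewrite leNgt; apply/negP => cfx.
have /clx[y [[_ /=]]] : nbhs x [set y | c < f y].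
  have /(cf x Ax) : nbhs (f x) [set z | c < z] by exact: lt_nbhsr.
  by [].
by rewrite leNgt => /negP.
Qed.

(** Below the scale d, the directions in which X is seen from p depend on the
    radius only up to k. For a cone with apex p, this holds for all k and d. *)
Definition conic_at (R : realType) (N : nat) (X : set 'rV[R]_N) (k d : R)
    (p : 'rV[R]_N) : Prop :=
  forall x, X x -> 0 < enorm (x - p) <= d -> forall r : R, 0 < r <= d ->
  exists x', [/\ X x', enorm (x' - p) = r &
    enorm (dir (x' - p) - dir (x - p)) <= k].

Definition uniformly_conic (R : realType) (N : nat) (X K : set 'rV[R]_N) :
    Prop :=
  forall k : R, 0 < k -> exists2 d : R, 0 < d & K `<=` conic_at X k d.

Section Conicity.
Context {R : realType} {N : nat}.
Implicit Types (X M K : set 'rV[R]_N) (p v w x y : 'rV[R]_N).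

(** A step short enough not to pass the target radius h, in either direction,
    whose turning is paid for by the variation of the gauge. *)
Lemma radial_step_toward X p x w (a h : R) : x != p -> 0 < a < 1 ->
    2 * enorm (x - p) `^ a <= 1 / 4 -> first_order_tangent X x w ->
    enorm (dir (x - p) - w) <= 2 * enorm (x - p) `^ a ->
    0 < h -> h != enorm (x - p) ->
  exists2 x', X x' &
    (enorm (x - p) < enorm (x' - p) < h \/ h < enorm (x' - p) < enorm (x - p))
    /\ enorm (dir (x' - p) - dir (x - p)) <=
       64 / a * `|enorm (x' - p) `^ a - enorm (x - p) `^ a|.
Proof.
move=> xp a01 r4 Xw wr h0 hr.
have r0 : 0 < enorm (x - p) by rewrite enorm_gt0 subr_eq0.
have [d d0 dP] : exists2 d : R, 0 < d & forall t : R, `|t| < d ->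
    exists2 x', X x' & `|enorm (x' - p) - (enorm (x - p) + t)| <= `|t| / 2 /\
    enorm (dir (x' - p) - dir (x - p)) <=
      8 * (2 * enorm (x - p) `^ a) * (`|t| / enorm (x - p)).
  by apply: radial_step xp Xw _ wr; rewrite r4 andbT mulr_gt0// powR_gt0.
set r := enorm (x - p) in r0 r4 wr hr dP *.
pose s := Num.min (d / 2) (Num.min (`|h - r| / 2) (r / 4)).
have s0 : 0 < s by rewrite !lt_min !divr_gt0// normr_gt0 subr_eq0.
have sd : s <= d / 2 by rewrite ge_min lexx.
have sh : s <= `|h - r| / 2 by rewrite !ge_min lexx orbT.
have sr : s <= r / 4 by rewrite !ge_min lexx !orbT.
clearbody s.
have [x' [Xx' [x's x'r] between dirx']] : exists x', [/\ X x',
    s / 2 <= `|enorm (x' - p) - r| /\ enorm (x' - p) <= 2 * r,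
    (r < enorm (x' - p) < h \/ h < enorm (x' - p) < r) &
    enorm (dir (x' - p) - dir (x - p)) <= 8 * (2 * r `^ a) * (s / r)].
  have [rh|hr'] := ltP r h.
  - have [|x' Xx' []] := dP s; first by rewrite gtr0_norm//; lra.
    rewrite [`|s|]gtr0_norm// ler_norml => /andP[x'1 x'2] x'3; exists x'.
    rewrite ger0_norm ?subr_ge0 in sh; last exact: ltW.
    split=> //; last by left; lra.
    have pos : 0 <= enorm (x' - p) - r by lra.
    by rewrite (ger0_norm pos); split; lra.
  - have [|x' Xx' []] := dP (- s); first by rewrite normrN gtr0_norm//; lra.
    rewrite normrN [`|s|]gtr0_norm// ler_norml => /andP[x'1 x'2] x'3; exists x'.
    have {}hr' : h < r by rewrite lt_neqAle hr.
    rewrite ltr0_norm ?subr_lt0// in sh.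
    split=> //; last by right; lra.
    have neg : enorm (x' - p) - r <= 0 by lra.
    by rewrite (ler0_norm neg); split; lra.
exists x' => //; split=> //.
apply: (le_trans dirx').
have a0 : 0 < a by case/andP: a01.
have -> : 8 * (2 * r `^ a) * (s / r) =
    64 / a * (a / 2 * r `^ a * ((s / 2) / r)).
  by field; rewrite !gt_eqF.
rewrite ler_wpM2l ?divr_ge0 ?(ltW a0)//.
rewrite (le_trans _ (powR_gauge a01 r0 _ _))//.
- rewrite ler_wpM2l ?mulr_ge0 ?powR_ge0 ?invr_ge0 ?(ltW a0)//.
  by rewrite ler_wpM2r// invr_ge0 ltW.
- by case: between => /andP[lo _]; apply: lt_trans lo.
Qed.

Lemma dist_between (a b c : R) : a < b < c \/ c < b < a ->
  `|a - c| = `|b - c| + `|b - a| /\ `|b - c| < `|a - c|.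
Proof.
case=> /andP[]; rewrite -subr_gt0 => h1; rewrite -subr_gt0 => h2.
- have h3 : 0 < c - a by lra.
  rewrite (distrC a) (distrC b c) (gtr0_norm h3) (gtr0_norm h2) (gtr0_norm h1).
  by split; lra.
- have h3 : 0 < a - c by lra.
  rewrite (distrC b a) (gtr0_norm h3) (gtr0_norm h2) (gtr0_norm h1).
  by split; lra.
Qed.

(** A point of X as close as possible to the target radius h, among those that
    have paid for their change of direction with the gauge, is at radius h:
    otherwise it could make one more step. *)
Lemma radial_flow X p (a d : R) : compact X -> 0 < a < 1 ->
    (forall x, X x -> 0 < enorm (x - p) <= d ->
      2 * enorm (x - p) `^ a <= 1 / 4 /\
      exists2 w, first_order_tangent X x w &
        enorm (dir (x - p) - w) <= 2 * enorm (x - p) `^ a) ->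
  forall x, X x -> 0 < enorm (x - p) <= d -> forall h : R, 0 < h <= d ->
  exists x', [/\ X x', enorm (x' - p) = h &
    enorm (dir (x' - p) - dir (x - p)) <=
      64 / a * `|enorm (x - p) `^ a - h `^ a|].
Proof.
move=> cX a01 dX x Xx /andP[r0 rd] h /andP[h0 hd].
set r := enorm (x - p) in r0 rd *.
have C0 : 0 <= 64 / a by case/andP: a01 => a0 _; rewrite divr_ge0// ltW.
pose m := Num.min r h; pose M := Num.max r h.
have m0 : 0 < m by rewrite lt_min r0.
have Md : M <= d by rewrite ge_max rd.
pose n y : R := enorm (y - p).
have nc : continuous n by exact: enorm_sub_continuous.
pose gap y : R := `|n y `^ a - h `^ a|.
pose A := X `&` [set y | - n y <= - m] `&` [set y | n y <= M].
have An y : A y -> 0 < n y by move=> [[_ /=]]; rewrite lerN2 => /(lt_le_trans m0).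
have gapc y : A y -> {for y, continuous gap}.
  move=> Ay; apply: (@continuous_comp _ _ _ n (fun s => `|s `^ a - h `^ a|)).
    exact: nc.
  have pc : {for n y, continuous (fun s : R => s `^ a)}.
    apply: differentiable_continuous; apply/derivable1_diffP.
    by apply: derivable_powR; rewrite in_itv/= andbT An.
  by apply: cvg_norm; apply: cvgB; [exact: pc | exact: cvg_cst].
pose turn y := enorm (dir (y - p) - dir (x - p)).
have turnc y : A y -> {for y, continuous turn}.
  move=> Ay; apply: (@continuous_lipschitz_at _ _ _ _ (2 / n y)).
    by rewrite divr_gt0// An.
  move=> z; rewrite (le_trans (enorm_dist _ _))// opprB addrA subrK.
  rewrite (le_trans (dir_lipschitz _ _))//; first by rewrite -enorm_gt0 An.
  by rewrite opprB addrA subrK mulrAC.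
have clA : closed A.
  apply: closed_sublevel => [|y _]; last exact: nc.
  apply: closed_sublevel => [|y _]; last by apply: continuousN; exact: nc.
  exact: compact_closed (@norm_hausdorff _ _) cX.
pose cost y := turn y + 64 / a * gap y.
pose S := A `&` [set y | cost y <= 64 / a * gap x].
have clS : closed S.
  apply: closed_sublevel => // y Ay; apply: continuousD; first exact: turnc.
  apply: continuousM; last exact: gapc.
  exact: cst_continuous.
have cS : compact S by apply: subclosed_compact clS cX _ => y [[[]]].
have Sx : S x.
  split; last by rewrite /= /cost /turn subrr enorm0 add0r.
  split; [split=> //=; rewrite lerN2 | rewrite /=].
    by rewrite ge_min lexx.
  by rewrite le_max lexx.
have [y Sy ymin] : exists2 y, y \in S & forall z, z \in S -> gap y <= gap z.
  apply: EVT_min_rV => //; first by exists x.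
  apply: continuous_in_subspaceT => z; rewrite inE => -[Az _]; exact: gapc.
rewrite inE in Sy; have [Ay /= ycost] := Sy; have [[Xy /=]] := Ay.
rewrite lerN2 => my yM; have n0 := An _ Ay.
have [yh|yh] := eqVneq h (n y).
  exists y; split=> //; apply: le_trans ycost.
  by rewrite lerDl mulr_ge0// normr_ge0.
have nyd : 0 < n y <= d by rewrite n0 (le_trans yM).
have [y4 [w Xw wy]] := dX y Xy nyd.
have yp : y != p by rewrite -subr_eq0 -enorm_gt0.
have [z Xz [between zcost]] := radial_step_toward yp a01 y4 Xw wy h0 yh.
have a0 : 0 < a by case/andP: a01.
have mono (s t : R) : 0 < s -> s < t -> s `^ a < t `^ a.
  by move=> s0 st; rewrite gt0_ltr_powR// nnegrE ltW// (lt_trans s0).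
have [gapz zy mz zM] : [/\ gap y = gap z + `|n z `^ a - n y `^ a|,
    gap z < gap y, m <= n z & n z <= M].
  have hm : m <= h by rewrite ge_min lexx orbT.
  have hM : h <= M by rewrite le_max lexx orbT.
  have [zy mz zM] : [/\ (n y `^ a < n z `^ a < h `^ a \/
      h `^ a < n z `^ a < n y `^ a), m <= n z & n z <= M].
    case: between => /andP[].
    - rewrite -/(n y) -/(n z) => yz zh; split.
      + left; apply/andP; split; apply: mono => //.
        exact: lt_trans n0 yz.
      + by rewrite (le_trans my)// ltW.
      + by rewrite (le_trans (ltW zh)).
    - rewrite -/(n y) -/(n z) => hz zy; split.
      + right; apply/andP; split; apply: mono => //.
        exact: lt_trans h0 hz.
      + by rewrite (le_trans hm)// ltW.
      + by rewrite (le_trans (ltW zy)).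
  by have [gapz1 gapz2] := dist_between zy; split.
have Sz : S z.
  split; first by split; [split; [|rewrite /= lerN2] |].
  apply: le_trans ycost; change (turn z + 64 / a * gap z <= cost y).
  rewrite /cost gapz mulrDr [X in _ <= _ + X]addrC addrA lerD2r.
  apply: le_trans (enorm_triangle _ (dir (y - p)) _) _.
  by rewrite [leLHS]addrC; apply: lerD zcost.
by move: (ymin z (mem_set Sz)); rewrite leNgt zy.
Qed.

End Conicity.

Section LojasiewiczConic.
Context {R : realType} {N : nat}.
Implicit Types (X M K : set 'rV[R]_N) (p v w x y : 'rV[R]_N).

Lemma smooth_on_cst (V W : normedModType R) (U : set V) (c : W) :
  smooth_on U (fun=> c).
Proof.
move=> k; elim: k c => [|k IHk] c /=; split=> //.
- by move=> x _; exact: cst_continuous.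
- by move=> x _; exact: cst_continuous.
- move=> v; split=> [x _|]; first exact: derivable_cst.
  have -> : (fun x : V => 'D_v (fun=> c) x) = (fun=> 0).
    by apply/funext => x; exact: derive_cst.
  exact: IHk.
Qed.

Lemma tangent_space0 M x : M x -> tangent_space M x 0.
Proof.
move=> Mx; exists 1, (fun=> x); split=> //.
  exact: smooth_on_cst.
by rewrite derive1_cst.
Qed.

Lemma first_order_tangentS M X x w : M `<=` X ->
  first_order_tangent M x w -> first_order_tangent X x w.
Proof.
move=> MX Mw e /Mw[d d0 dM]; exists d => // t /dM[x' Mx' ?].
by exists x' => //; exact: MX.
Qed.

Lemma powR_small (a c : R) : 0 < a -> 0 < c ->
  exists2 d : R, 0 < d & forall r, 0 <= r -> r <= d -> r `^ a <= c.
Proof.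
move=> a0 c0; exists (c `^ a^-1) => [|r r0 rd]; first exact: powR_gt0.
have -> : c = (c `^ a^-1) `^ a by rewrite -powRrM mulVf ?gt_eqF// powRr1// ltW.
by rewrite ge0_ler_powR ?nnegrE ?powR_ge0// ltW.
Qed.

(** The secant from x to a point p of K is tangent at x to the stratum of x up
    to an error r^a, where r is the distance of x from p. Hence the radial flow
    towards or away from p turns by O(d^a) in total below the scale d. *)
Lemma lojasiewicz_uniformly_conic (q : nat) X (s : 'rV[R]_N -> bool)
    (i : bool) K :
  compact X -> lojasiewicz_whitney q X s -> compact K ->
  K `<=` stratum X s i -> uniformly_conic X K.
Proof.
move=> cX [_ LW] cK Ki k k0.
have [al [d0 [al0 d00 beta]]] := LW K i cK Ki.
(* an exponent below 1, for concavity; on radii at most 1 the bound persists *)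
pose a := Num.min al (1 / 2).
have a01 : 0 < a < 1.
  by rewrite lt_min al0 /= gt_min; apply/andP; split; [lra | apply/orP; right; lra].
have a0 : 0 < a by case/andP: a01.
have [d1 d10 d1P] : exists2 d : R, 0 < d &
    forall r, 0 <= r -> r <= d -> r `^ a <= Num.min (1 / 8) (k * a / 64).
  by apply: powR_small => //; rewrite lt_min !divr_gt0// mulr_gt0.
exists (Num.min 1 (Num.min d0 d1)) => [|p Kp]; first by rewrite !lt_min ltr01 d00.
set d := Num.min _ _.
have d1' : d <= 1 by rewrite ge_min lexx.
have dd0 : d <= d0 by rewrite !ge_min lexx orbT.
have dd1 : d <= d1 by rewrite !ge_min lexx !orbT.
have tangent x : X x -> 0 < enorm (x - p) <= d ->
    2 * enorm (x - p) `^ a <= 1 / 4 /\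
    exists2 w, first_order_tangent X x w &
      enorm (dir (x - p) - w) <= 2 * enorm (x - p) `^ a.
  move=> Xx /andP[r0 rd].
  have := d1P _ (ltW r0) (le_trans rd dd1); rewrite le_min => /andP[r8 _].
  split; first lra.
  have Xsx : stratum X s (s x) x by split.
  have xp : x != p by rewrite -subr_eq0 -enorm_gt0.
  have := beta x p Kp Xx (le_trans rd dd0).
  rewrite /lw_beta (negbTE xp) enormB => le_al.
  have le_a : enorm (x - p) `^ al <= enorm (x - p) `^ a.
    apply: ger_powR; first by rewrite r0 (le_trans rd).
    by rewrite ge_min lexx.
  have dir_secant : secant x p (dir (x - p)).
    by rewrite /secant/= memvZ// memv_line.
  have dir1 : enorm (dir (x - p)) = 1 by rewrite enorm_dir// subr_eq0.
  have lt_2a : dvec (secant x p) (tangent_space (stratum X s (s x)) x) <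
      2 * enorm (x - p) `^ a by have := powR_gt0 a r0; lra.
  have [w Tw /ltW wP] := dvec_lt_approx dir_secant dir1 (tangent_space0 Xsx) lt_2a.
  exists w => //; apply: first_order_tangentS (tangent_space_first_order Tw).
  by move=> z [].
move=> x Xx xd h hd.
have [x' [Xx' x'h x'P]] := radial_flow cX a01 tangent Xx xd hd.
exists x'; split=> //; apply: (le_trans x'P).
move: xd hd => /andP[r0 rd] /andP[h0 hd].
have := d1P _ (ltW r0) (le_trans rd dd1); rewrite le_min => /andP[_ rk].
have := d1P _ (ltW h0) (le_trans hd dd1); rewrite le_min => /andP[_ hk].
have -> : k = 64 / a * (k * a / 64) by field; rewrite gt_eqF.
rewrite ler_wpM2l ?divr_ge0 ?(ltW a0)// ler_norml.
have rp := powR_ge0 (enorm (x - p)) a; have hp := powR_ge0 h a.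
by apply/andP; split; lra.
Qed.

End LojasiewiczConic.

(** * Magnifications of a conic space *)

(** Data (X', x0) that, magnified by z, differ from (X, p) by at most h. *)
Definition zoom_approx (R : realType) (N : nat) (X : set 'rV[R]_N) (h z : R)
    (p x0 : 'rV[R]_N) (X' : set 'rV[R]_N) : Prop :=
  [/\ h^-1 < z, enorm (x0 - p) <= h / z,
      X' `<=` thickening X (h / z) & X `<=` thickening X' (h / z)].

Section Magnification.
Context {R : realType} {N : nat}.
Implicit Types (X K : set 'rV[R]_N) (p v w x y : 'rV[R]_N).

Lemma compact_sphere : compact [set v : 'rV[R]_N | enorm v = 1].
Proof.
have nc x : {for x, continuous (fun v : 'rV[R]_N => enorm (v - 0))}.
  exact: enorm_sub_continuous.
apply: bounded_closed_compact.
  exists 1; split; first exact: num_real.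
  move=> M M1 v /= v1; rewrite (le_trans (normr_le_enorm _))// v1.
  exact: ltW.
have -> : [set v : 'rV[R]_N | enorm v = 1] = setT
    `&` [set v | enorm (v - 0) <= 1] `&` [set v | - enorm (v - 0) <= - 1].
  apply/seteqP; split=> v /=; rewrite subr0; first by move=> ->.
  by move=> [[_ v1]]; rewrite lerN2 => v2; apply/eqP; rewrite eq_le v1.
apply: closed_sublevel => [|x _]; last by apply: continuousN; exact: nc.
by apply: closed_sublevel => [|x _]; [exact: closedT | exact: nc].
Qed.

Lemma ext_tangent_cone0 X p : X p -> ext_tangent_cone X p 0.
Proof.
move=> Xp e e0; exists p; split=> //; first by rewrite /eball/= subrr enorm0 ltW.
by exists 0; [exists 0; rewrite /= ?lexx ?scale0r | rewrite subrr enorm0 ltW].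
Qed.

Lemma ext_tangent_coneZ X p v (m : R) : 0 <= m ->
  ext_tangent_cone X p v -> ext_tangent_cone X p (m *: v).
Proof.
move=> m0 Tv e e0.
have m1 : 0 < m + 1 by rewrite ltr_wpDl.
have e'0 : 0 < e / (m + 1) by rewrite divr_gt0.
have e'e : e / (m + 1) <= e by rewrite ler_pdivrMr// ler_peMr ?(ltW e0)// lerDr.
have [y [yp Xy [_ [t t0 <-] tv]]] := Tv _ e'0.
exists y; split=> //; first exact: le_trans e'e.
exists ((m * t) *: (y - p)); first by exists (m * t) => //=; exact: mulr_ge0.
rewrite -scalerA -scalerBr enormZ ger0_norm//.
apply: (@le_trans _ _ (m * (e / (m + 1)))); first by rewrite ler_wpM2l.
rewrite mulrCA ler_piMr ?(ltW e0)// ler_pdivrMr// mul1r lerDl//.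
Qed.

(** The tangent vector is a limit point of the directions of points of X that
    follow the direction of x down to p. *)
Lemma conic_tangent_direction X (k d : R) p x : 0 < d -> conic_at X k d p ->
    X x -> 0 < enorm (x - p) <= d ->
  exists v, [/\ ext_tangent_cone X p v, enorm v = 1 &
    enorm (dir (x - p) - v) <= k].
Proof.
move=> d0 conic Xx xd.
have /choice[f fP] (n : nat) : exists x', [/\ X x',
    enorm (x' - p) = d / n.+1%:R & enorm (dir (x' - p) - dir (x - p)) <= k].
  apply: conic => //; rewrite divr_gt0//= ler_pdivrMr// ler_peMr ?(ltW d0)//.
  by rewrite ler1n.
pose u n := dir (f n - p).
have [v [v1 clv]] : [set v | enorm v = 1] `&` cluster (u @ \oo) !=set0.
  apply: compact_sphere; exists 0%N => // n _ /=.
  have [_ fn _] := fP n; rewrite enorm_dir// -enorm_gt0 fn divr_gt0//.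
have close (e : R) (m : nat) : 0 < e ->
    exists2 n, (m <= n)%N & enorm (u n - v) < e.
  move=> e0.
  have tail : (u @ \oo) (u @` [set n | (m <= n)%N]).
    by exists m => // n mn; exists n.
  have nbhsv : nbhs v [set w | enorm (w - v) < e].
    by apply/nbhs_enorm; exists e.
  by have [_ [[n mn <-] unv]] := clv _ _ tail nbhsv; exists n.
exists v; split=> // [e e0|].
  have [m mP] : exists m : nat, d / e < m%:R.
    by exists (Num.bound (d / e)); rewrite archi_boundP// divr_ge0 ?ltW.
  have [n mn /ltW un] := close e m e0; have [Xn fn _] := fP n.
  exists (f n); split=> //.
    rewrite /eball/= fn ler_pdivrMr// mulrC -ler_pdivrMr//.
    by rewrite (le_trans (ltW mP))// ler_nat ltnW.
  exists (u n) => //; exists (enorm (f n - p))^-1 => //=.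
  by rewrite invr_ge0 enorm_ge0.
apply/ler_addgt0Pr => e e0; have [n _ /ltW un] := close e 0%N e0.
have [_ _ fn] := fP n.
by rewrite (le_trans (enorm_triangle _ (u n) _))// lerD// enormB.
Qed.

(** Conversely, a tangent vector is followed from points close to p, where it is
    almost the direction of a point of X, out to the radius r. *)
Lemma tangent_direction_conic X (k d : R) p v : 0 < k -> 0 < d ->
    conic_at X k d p -> ext_tangent_cone X p v -> enorm v = 1 ->
  forall r, 0 < r <= d -> exists x, [/\ X x, enorm (x - p) = r &
    enorm (dir (x - p) - v) <= 2 * k].
Proof.
move=> k0 d0 conic Tv v1 r rd.
pose e := Num.min d (Num.min (k / 2) (1 / 2)).
have e0 : 0 < e by rewrite !lt_min d0 !divr_gt0.
have ed : e <= d by rewrite ge_min lexx.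
have ek : e <= k / 2 by rewrite !ge_min lexx orbT.
have eh : e <= 1 / 2 by rewrite !ge_min lexx !orbT.
have [y [yp Xy [_ [t /= t0 <-] tv]]] := Tv e e0.
have ty0 : 0 < enorm (t *: (y - p)).
  have := enorm_triangle v (t *: (y - p)) 0; rewrite !subr0 v1 enormB.
  by lra.
have y0 : y - p != 0.
  by move: ty0; rewrite enorm_gt0 scaler_eq0 negb_or => /andP[].
have {}t0 : 0 < t.
  by move: ty0; rewrite enorm_gt0 scaler_eq0 negb_or lt_def t0 andbT => /andP[].
have dirv : enorm (dir (y - p) - v) <= k.
  have v0 : v != 0 by rewrite -enorm_gt0 v1.
  have := dir_lipschitz (t *: (y - p)) v0.
  by rewrite dirZ// (dir_unit v1) v1 divr1 => h; lra.
have yd : 0 < enorm (y - p) <= d by rewrite enorm_gt0 y0 (le_trans yp).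
have [x [Xx xr xy]] := conic y Xy yd r rd.
exists x; split=> //; rewrite (le_trans (enorm_triangle _ (dir (y - p)) _))//.
by lra.
Qed.

(** Directions seen from two base points that are close at the scale r. *)
Lemma dir_change_base x p p' (r h : R) : 0 < r -> h <= 1 / 4 ->
    enorm (x - p) = r -> enorm (p - p') <= h * r ->
  0 < enorm (x - p') <= 2 * r /\ enorm (dir (x - p') - dir (x - p)) <= 2 * h.
Proof.
move=> r0 h4 xr pp.
have hr : h * r <= r / 4 by rewrite mulrC ler_wpM2l ?(ltW r0)//; lra.
have := enorm_triangle x p p'; have := enorm_triangle x p' p.
rewrite xr (enormB p' p) => t1 t2; split; first by apply/andP; split; lra.
have xp0 : x - p != 0 by rewrite -enorm_gt0 xr.
rewrite (le_trans (dir_lipschitz _ xp0))// xr ler_pdivrMr//.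
have -> : x - p' - (x - p) = p - p' by rewrite opprB addrC subrKA.
by lra.
Qed.


Lemma enorm_scale_close (s t : R) v w : 0 <= s -> s <= 1 -> enorm w <= 1 ->
  enorm (s *: v - t *: w) <= enorm (v - w) + `|s - t|.
Proof.
move=> s0 s1 w1.
have -> : s *: v - t *: w = s *: (v - w) + (s - t) *: w.
  by rewrite scalerBr scalerBl subrKA.
rewrite (le_trans (enormD _ _))// !enormZ ger0_norm// lerD//.
  by rewrite ler_piMl ?enorm_ge0.
by rewrite ler_piMr.
Qed.

Lemma dSamStar_le (B B' : set 'rV[R]_N) (e : R) : 0 < e ->
    (forall v, B v -> enorm v <= 1 ->
      exists2 w, B' w /\ enorm w <= 1 & enorm (w - v) <= e) ->
    (forall v, B' v -> enorm v <= 1 ->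
      exists2 w, B w /\ enorm w <= 1 & enorm (w - v) <= e) ->
  (dSamStar B B' <= e%:E)%E.
Proof.
move=> e0 BB' B'B; apply: ereal_inf_lbound; exists e => //; split=> //.
- move=> v [Bv]; rewrite /eball/= subr0 => v1.
  by have [w [B'w w1] wv] := BB' v Bv v1; exists w; rewrite /eball/= ?subr0.
- move=> v [B'v]; rewrite /eball/= subr0 => v1.
  by have [w [Bw w1] wv] := B'B v B'v v1; exists w; rewrite /eball/= ?subr0.
Qed.

(** Zooming in at base points tending to y, in sets that approximate X at the
    magnified scale, yields the tangent cone at y: a direction seen from p at a
    small scale is transported by conicity to the fixed scale d / 2, where the
    base point can be moved from p to y, and back to scale zero at y. *)
Lemma magnification_near_cone X K (e : R) y : uniformly_conic X K -> K `<=` X ->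
    K y -> 0 < e ->
  exists2 h : R, 0 < h & forall p, K p -> enorm (p - y) < h ->
    forall (z : R) x0 X', zoom_approx X h z p x0 X' ->
    (dSamStar (ext_tangent_cone X y) (magnification z x0 X') <= e%:E)%E.
Proof.
move=> conic KX Ky e0.
(* k bounds the turning between scales, 2 m the effect of moving the base
   point at the scale r; the total error is at most 4 k + 8 m <= e *)
pose k := e / 8; have k0 : 0 < k by rewrite divr_gt0.
have [d d0 dK] := conic k k0.
pose r := d / 2; have r0 : 0 < r by rewrite divr_gt0.
have rd : 0 < r <= d by rewrite r0 /= /r; lra.
pose m := Num.min (e / 16) (1 / 4).
have m0 : 0 < m by rewrite lt_min !divr_gt0.
have me : m <= e / 16 by rewrite ge_min lexx.
have m4 : m <= 1 / 4 by rewrite ge_min lexx orbT.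
exists (Num.min m (m * r)) => [|p Kp]; first by rewrite lt_min m0 mulr_gt0.
set h := Num.min _ _ => py z x0 X' [hz x0p X'X XX'].
have hm : h <= m by rewrite ge_min lexx.
have hmr : h <= m * r by rewrite ge_min lexx orbT.
have h0 : 0 < h by rewrite lt_min m0 mulr_gt0.
have z0 : 0 < z by apply: lt_trans hz; rewrite invr_gt0.
have zr : 2 / z <= r.
  have : z^-1 <= h by rewrite invf_ple ?posrE// ltW.
  have : m * r <= r / 4 by rewrite mulrC ler_wpM2l ?(ltW r0)//; lra.
  by lra.
have zhz (w : 'rV[R]_N) : enorm w <= h / z -> enorm (z *: w) <= m.
  move=> wh; rewrite enormZ gtr0_norm// mulrC -ler_pdivlMr//.
  by rewrite (le_trans wh)// ler_wpM2r// invr_ge0 ltW.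
have shift x x' : enorm (x' - x) <= h / z ->
    enorm (z *: (x' - x0) - z *: (x - p)) <= 2 * m.
  move=> xx'; have -> : z *: (x' - x0) - z *: (x - p) =
      z *: (x' - x) - z *: (x0 - p).
    rewrite -!scalerBr; congr (_ *: _).
    by rewrite !opprB addrACA [- x0 - x]addrC -addrACA.
  rewrite (le_trans (enormD _ _))// enormN mulr2n mulrDl mul1r.
  by rewrite lerD ?zhz.
clear conic hz zhz.
have py' : enorm (p - y) <= m * r by rewrite (le_trans (ltW py)).
apply: dSamStar_le => // [v Tv v1|_ [[x' X'x' <-]]].
- (* x, then x2, and finally x' in X' follow the direction of v *)
  suff [x2 [Xx2 x2v x2_1]] : exists x2, [/\ X x2,
      enorm (z *: (x2 - p) - v) <= 3 * k + 4 * m &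
      enorm (z *: (x2 - p)) <= 1 - 2 * m].
    have [x' X'x' /shift x'x2] := XX' x2 Xx2.
    have t1 := enorm_triangle (z *: (x' - x0)) (z *: (x2 - p)) v.
    have t2 := enorm_triangle (z *: (x' - x0)) (z *: (x2 - p)) 0.
    rewrite !subr0 in t2.
    have a1 : enorm (z *: (x' - x0)) <= 1 by lra.
    exists (z *: (x' - x0)); last by rewrite /k in x2v; lra.
    by split=> //; split; [exists x' | rewrite /eball/= subr0].
  have [->|v0] := eqVneq v 0.
    exists p; rewrite subrr scaler0 subrr enorm0; split; [exact: KX|lra|lra].
  have Tdir : ext_tangent_cone X y (dir v).
    by apply: ext_tangent_coneZ => //; rewrite invr_ge0 enorm_ge0.
  have [x [Xx xr xv]] :=
    tangent_direction_conic k0 d0 (dK y Ky) Tdir (enorm_dir v0) rd.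
  have [xp dirx] : 0 < enorm (x - p) <= 2 * r /\
      enorm (dir (x - p) - dir (x - y)) <= 2 * m.
    by apply: dir_change_base => //; rewrite enormB.
  (* the margin 2 m keeps the approximating point of X' in the unit ball *)
  pose n := Num.min (enorm v) (1 - 2 * m).
  have n0 : 0 < n by rewrite lt_min enorm_gt0 v0 /=; lra.
  have n1 : n <= 1 - 2 * m by rewrite ge_min lexx orbT.
  have nv : n <= enorm v by rewrite ge_min lexx.
  have vn : enorm v - 2 * m <= n by rewrite le_min; apply/andP; split; lra.
  have xpd : 0 < enorm (x - p) <= d.
    by move: xp; rewrite [2 * r]mulrC divfK.
  have nzd : 0 < n / z <= d.
    rewrite divr_gt0//= (le_trans _ (_ : r <= d))//; last by case/andP: rd.
    rewrite (le_trans _ zr)// ler_wpM2r ?invr_ge0 ?(ltW z0)//; lra.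
  have [x2 [Xx2 x2n x2x]] := dK p Kp x Xx xpd _ nzd.
  have x2E : z *: (x2 - p) = n *: dir (x2 - p).
    by rewrite /dir x2n scalerA invf_div mulrCA divff ?mulr1// gt_eqF.
  exists x2; split=> //; rewrite x2E; last first.
    rewrite enormZ (gtr0_norm n0) (le_trans _ n1)//.
    by rewrite ler_piMr ?enorm_dir_le1 ?(ltW n0).
  rewrite -{1}(scale_dir v).
  have n1' : n <= 1 by lra.
  apply: (le_trans (enorm_scale_close _ _ (ltW n0) n1' (enorm_dir_le1 v))).
  have t1 := enorm_triangle (dir (x2 - p)) (dir (x - p)) (dir v).
  have t2 := enorm_triangle (dir (x - p)) (dir (x - y)) (dir v).
  have n_v : n - enorm v <= 0 by lra.
  by rewrite (ler0_norm n_v); lra.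
- rewrite /eball/= subr0 => a1 _.
  have [x Xx xx'] := X'X x' X'x'.
  have {xx'}xa : enorm (z *: (x' - x0) - z *: (x - p)) <= 2 * m.
    by apply: shift; rewrite enormB.
  suff [v [Tv v1 xv]] : exists v, [/\ ext_tangent_cone X y v, enorm v <= 1 &
      enorm (v - z *: (x - p)) <= 2 * k + 4 * m].
    exists v => //.
    have t1 := enorm_triangle v (z *: (x - p)) (z *: (x' - x0)).
    by rewrite [X in _ <= _ + X]enormB in t1; rewrite /k in xv; lra.
  have [xp|xp] := eqVneq x p.
    exists 0; rewrite xp subrr scaler0 subrr enorm0.
    by split; [exact: ext_tangent_cone0 (KX _ Ky)|lra|lra].
  rewrite -subr_eq0 in xp.
  have t1 := enorm_triangle (z *: (x - p)) (z *: (x' - x0)) 0.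
  rewrite !subr0 [X in _ <= X + _]enormB in t1.
  have xpE : enorm (x - p) = enorm (z *: (x - p)) / z.
    by rewrite enormZ gtr0_norm// mulrAC divff ?mul1r// gt_eqF.
  have xpd : 0 < enorm (x - p) <= d.
    rewrite enorm_gt0 xp xpE (le_trans _ (_ : r <= d))//; last by case/andP: rd.
    rewrite (le_trans _ zr)// ler_wpM2r ?invr_ge0 ?(ltW z0)//; lra.
  have [x2 [Xx2 x2r x2x]] := dK p Kp x Xx xpd r rd.
  have [x2y dirx2] := dir_change_base r0 m4 x2r py'.
  have x2yd : 0 < enorm (x2 - y) <= d by move: x2y; rewrite [2 * r]mulrC divfK.
  have [v [Tv v1 vx2]] := conic_tangent_direction d0 (dK y Ky) Xx2 x2yd.
  pose n := Num.min 1 (enorm (z *: (x - p))).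
  have n0 : 0 <= n by rewrite le_min ler01 enorm_ge0.
  have n1 : n <= 1 by rewrite ge_min lexx.
  have nb : n - enorm (z *: (x - p)) <= 0 by rewrite subr_le0 ge_min lexx orbT.
  have bn : enorm (z *: (x - p)) - 2 * m <= n.
    by rewrite le_min; apply/andP; split; lra.
  exists (n *: v); split; first exact: ext_tangent_coneZ.
    by rewrite enormZ v1 mulr1 ger0_norm.
  rewrite -{1}(scale_dir (z *: (x - p))) (dirZ _ z0).
  apply: (le_trans (enorm_scale_close _ _ n0 n1 (enorm_dir_le1 (x - p)))).
  have t2 := enorm_triangle v (dir (x2 - y)) (dir (x - p)).
  have t3 := enorm_triangle (dir (x2 - y)) (dir (x2 - p)) (dir (x - p)).
  rewrite [X in _ <= X + _]enormB in t2.
  by rewrite (ler0_norm nb); lra.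
Qed.

End Magnification.

(** * The tangent cone of a smooth submanifold *)

(** Row vectors: the differential at x is h |-> h *m A. *)
Definition frechet (R : realType) (N : nat) (f : 'rV[R]_N -> 'rV[R]_N)
    (x : 'rV[R]_N) (A : 'M[R]_N) : Prop :=
  forall e : R, 0 < e -> exists2 d : R, 0 < d & forall h, enorm h < d ->
    enorm (f (x + h) - f x - h *m A) <= e * enorm h.

Section Frechet.
Context {R : realType} {N : nat}.
Implicit Types (f g : 'rV[R]_N -> 'rV[R]_N) (h u v x y : 'rV[R]_N).

Lemma enorm_le_coord u v : (forall i, `|u 0 i| <= `|v 0 i|) ->
  enorm u <= enorm v.
Proof.
move=> uv; rewrite ler_sqrt ?sumr_ge0// => [|i _]; last exact: sqr_ge0.
rewrite ler_sum// => i _.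
rewrite -[u 0 i ^+ 2]real_normK ?num_real// -[leRHS]real_normK ?num_real//.
by rewrite lerXn2r ?nnegrE.
Qed.

Lemma enorm_le_bound v (c : R) : 0 <= c -> (forall i, `|v 0 i| <= c) ->
  enorm v <= N%:R * c.
Proof.
move=> c0 vc; rewrite (le_trans (enorm_le_normr _))// ler_wpM2l//.
rewrite [leLHS]/Num.Def.normr/= mx_normrE bigmax_le// => -[i j] _ /=.
by rewrite ord1.
Qed.

Lemma enorm_sum (I : finType) (F : I -> 'rV[R]_N) :
  enorm (\sum_i F i) <= \sum_i enorm (F i).
Proof.
elim/big_ind2 : _ => [|a b c d ab cd|//]; first by rewrite enorm0.
by rewrite (le_trans (enormD _ _))// lerD.
Qed.

Lemma mulmx_bounded (A : 'M[R]_N) :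
  exists2 c : R, 0 < c & forall v, enorm (v *m A) <= c * enorm v.
Proof.
exists (1 + \sum_i enorm (row i A)) => [|v].
  by rewrite ltr_pwDl// sumr_ge0// => i _; exact: enorm_ge0.
rewrite mulmx_sum_row (le_trans (enorm_sum _))// mulrDl mul1r.
rewrite ler_wpDl ?enorm_ge0// mulr_suml ler_sum// => i _.
by rewrite enormZ mulrC ler_wpM2l ?enorm_ge0// coord_le_enorm.
Qed.

(** The mean value theorem applies to one coordinate at a time, whence the
    factor N. *)
Lemma mean_value_step f y v (t : R) (D : 'rV[R]_N) (e : R) :
    (forall s : R, `|s| <= `|t| -> derivable f (y + s *: v) v /\
      enorm ('D_v f (y + s *: v) - D) <= e) ->
  enorm (f (y + t *: v) - f y - t *: D) <= N%:R * (e * `|t|).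
Proof.
move=> fD.
have e0 : 0 <= e.
  by have [_ /(le_trans (enorm_ge0 _))] := fD t (lexx _).
apply: enorm_le_bound => [|j]; first by rewrite mulr_ge0.
pose phi (s : R) := f (y + s *: v) 0 j.
pose dphi (s : R) := ('D_v f (y + s *: v)) 0 j.
have phi' (s : R) : `|s| <= `|t| -> is_derive s 1 phi (dphi s).
  move=> st; have [ds _] := fD s st.
  have quot : (fun h : R => h^-1 *: ((phi \o shift s) (h *: 1) - phi s)) =
      (fun h : R => h^-1 *: (((fun z => f z 0 j) \o shift (y + s *: v)) (h *: v)
        - f (y + s *: v) 0 j)).
    apply/funext => h /=; rewrite /phi -[_ *: 1]/(h * 1) mulr1 scalerDl.
    by rewrite addrCA.
  have dj := (derivable_mxP _ _ _).1 ds 0 j.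
  apply: DeriveDef; first by rewrite /derivable quot.
  by rewrite /derive quot /dphi (derive_mx ds) mxE.
have key (a b : R) : a <= b -> - `|t| <= a -> b <= `|t| ->
    `|phi b - phi a - (b - a) * D 0 j| <= e * (b - a).
  move=> ab ta bt.
  have inside (s : R) : a <= s <= b -> `|s| <= `|t|.
    by move=> /andP[as_ sb]; rewrite ler_norml (le_trans ta as_) (le_trans sb bt).
  have [s||s sab ->] := @MVT_segment R phi dphi a b ab.
  - rewrite in_itv/= => /andP[/ltW as_ /ltW sb].
    by apply: phi'; apply: inside; rewrite as_.
  - apply: continuous_in_subspaceT => s; rewrite inE/= in_itv/= => sab.
    apply: differentiable_continuous; apply/derivable1_diffP.
    by case: (phi' s (inside s sab)).
  have ba0 : 0 <= b - a by rewrite subr_ge0.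
  have -> : dphi s * (b - a) - (b - a) * D 0 j = (dphi s - D 0 j) * (b - a).
    by ring.
  rewrite normrM (ger0_norm ba0) ler_wpM2r//.
  have [_] := fD s (inside s sab); apply: le_trans.
  by rewrite /dphi (le_trans _ (coord_le_enorm _ j))// !mxE.
rewrite !mxE -/(phi t); have -> : f y 0 j = phi 0 by rewrite /phi scale0r addr0.
have [t0|/ltW t0] := leP 0 t.
- have := key 0 t t0; rewrite subr0 ger0_norm// oppr_le0 t0 lexx.
  exact.
- have := key t 0 t0; rewrite sub0r ler0_norm// opprK lexx oppr_ge0 t0.
  move=> /(_ isT isT).
  have -> : phi t - phi 0 - t * D 0 j = - (phi 0 - phi t - - t * D 0 j) by ring.
  by rewrite normrN.
Qed.

Lemma radius_forall (P : 'I_N -> 'rV[R]_N -> Prop) x :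
    (forall i, exists2 d : R, 0 < d & forall y, enorm (y - x) < d -> P i y) ->
  exists2 d : R, 0 < d & forall y, enorm (y - x) < d -> forall i, P i y.
Proof.
move=> /(_ _)/cid2-/all_sig[d dP].
exists (\big[Order.min/1]_i d i) => [|y yd i].
  by apply: lt_bigmin => // i _; have [] := dP i.
by have [_] := dP i; apply; rewrite (lt_le_trans yd)// bigmin_le_cond.
Qed.

(** Continuous partial derivatives suffice: f is compared with its linear part
    along a broken line with edges parallel to the axes. *)
Lemma C1_frechet f x (U : set 'rV[R]_N) : open U -> U x -> smooth_on U f ->
  frechet f x (\matrix_(i < N) 'D_(delta_mx 0 i) f x).
Proof.
move=> oU Ux /(_ 1%N)[_ C1] e e0; set A := \matrix_(i < N) _.
pose eps := e / (N%:R * N%:R + 1).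
have NN : 0 < (N%:R * N%:R + 1 : R) by rewrite ltr_wpDl// mulr_ge0.
have eps0 : 0 < eps by rewrite divr_gt0.
have epsE : eps * (N%:R * N%:R + 1) = e by rewrite divfK// gt_eqF.
clearbody eps.
have [dU dU0 dUP] := (nbhs_enorm _ _).1 (open_nbhs_nbhs (conj oU Ux)).
have [dD dD0 dDP] : exists2 d : R, 0 < d & forall y, enorm (y - x) < d ->
    forall i : 'I_N,
      enorm ('D_(delta_mx 0 i) f y - 'D_(delta_mx 0 i) f x) < eps.
  apply: radius_forall => i; have [_ [cD _]] := C1 (delta_mx 0 i).
  pose D : 'rV[R]_N := 'D_(delta_mx 0 i) f x.
  have nbD : nbhs D [set w | enorm (w - D) < eps].
    by apply/nbhs_enorm; exists eps.
  apply: (nbhs_enorm _ [set y | enorm ('D_(delta_mx 0 i) f y - D) < eps]).1.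
  exact: (cD x Ux _ nbD).
pose d := Num.min dU dD.
have d0 : 0 < d by rewrite lt_min dU0.
have dP y : enorm (y - x) < d -> U y /\ forall i : 'I_N,
    enorm ('D_(delta_mx 0 i) f y - 'D_(delta_mx 0 i) f x) < eps.
  by rewrite lt_min => /andP[/dUP Uy /dDP Dy].
exists d => // h hd.
pose y k := x + \row_(j < N) (h 0 j * (j < k)%N%:R).
have yS (i : 'I_N) : y i.+1 = y i + h 0 i *: delta_mx 0 i.
  rewrite /y -addrA; congr (_ + _); apply/rowP => j; rewrite !mxE eqxx/= ltnS.
  have [->|ji] := eqVneq j i; first by rewrite leqnn ltnn mulr0 add0r.
  by rewrite mulr0 addr0 leq_eqVlt val_eqE (negbTE ji).
have -> : f (x + h) - f x - h *m A =
    \sum_(i < N) (f (y i.+1) - f (y i) - h 0 i *: 'D_(delta_mx 0 i) f x).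
  rewrite sumrB mulmx_sum_row; congr (_ - _); last first.
    by apply: eq_bigr => i _; rewrite rowK.
  rewrite -(big_mkord xpredT (fun i => f (y i.+1) - f (y i))) telescope_sumr//.
  congr (f _ - f _); rewrite /y; last first.
    by rewrite [X in _ + X](_ : _ = 0) ?addr0//; apply/rowP => j; rewrite !mxE mulr0.
  by congr (_ + _); apply/rowP => j; rewrite !mxE ltn_ord mulr1.
rewrite (le_trans (enorm_sum _))//.
apply: (@le_trans _ _ (\sum_(i < N) N%:R * (eps * enorm h))).
  apply: ler_sum => i _; rewrite yS.
  apply: (@le_trans _ _ (N%:R * (eps * `|h 0 i|))); last first.
    by rewrite !ler_wpM2l ?(ltW eps0)// coord_le_enorm.
  apply: mean_value_step => t th.
  have yd : enorm (y i + t *: delta_mx 0 i - x) < d.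
    apply: le_lt_trans hd; apply: enorm_le_coord => j.
    rewrite /y -(addrA x) [x + _]addrC addrK !mxE eqxx/=.
    have [->|_] := eqVneq j i; first by rewrite ltnn mulr0 add0r mulr1.
    by rewrite mulr0 addr0; case: ltnP => _; rewrite ?mulr1// mulr0 normr0.
  have [Uy Dy] := dP _ yd; split; last exact/ltW.
  by have [drv _] := C1 (delta_mx 0 i); exact: drv.
rewrite sumr_const card_ord -[leLHS]mulr_natl !mulrA ler_wpM2r ?enorm_ge0//.
by rewrite -[leRHS]epsE mulrC ler_wpM2l ?(ltW eps0)// lerDl.
Qed.

(** The chain rule for the identity near y. *)
Lemma frechet_cancel f g y (A B : 'M[R]_N) (U : set 'rV[R]_N) :
    open U -> U y -> (forall z, U z -> g (f z) = z) ->
    frechet f y A -> frechet g (f y) B ->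
  A *m B = 1%:M.
Proof.
move=> oU Uy gf fA gB; apply/row_matrixP => i; rewrite row_mul row1.
set v : 'rV_N := delta_mx 0 i.
have -> : row i A = v *m A by rewrite rowE.
apply/eqP; rewrite -subr_eq0 -enorm_eq0 eq_le enorm_ge0 andbT.
have [b b0 bP] := mulmx_bounded B; have [a a0 aP] := mulmx_bounded A.
have [r r0 rU] := (nbhs_enorm _ _).1 (open_nbhs_nbhs (conj oU Uy)).
have v0 : 0 < enorm v + 1 by rewrite ltr_wpDl ?enorm_ge0.
apply/ler_addgt0Pr => e e0; rewrite add0r.
pose c := (a + 1) * (enorm v + 1).
have c0 : 0 < c by rewrite mulr_gt0// addr_gt0.
pose k := Num.min 1 (e / (c + b * (enorm v + 1))).
have cb0 : 0 < c + b * (enorm v + 1) by rewrite addr_gt0// mulr_gt0.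
have k0 : 0 < k by rewrite lt_min ltr01 divr_gt0.
have k1 : k <= 1 by rewrite ge_min lexx.
have ke : k * (c + b * (enorm v + 1)) <= e.
  by rewrite -ler_pdivlMr// ge_min lexx orbT.
have [df df0 dfP] := fA k k0; have [dg dg0 dgP] := gB k k0.
pose t := Num.min (r / (2 * (enorm v + 1)))
  (Num.min (df / (2 * (enorm v + 1))) (dg / (2 * c))).
have t0 : 0 < t by rewrite !lt_min !divr_gt0// mulr_gt0.
have small (s w : R) : 0 < s -> 0 < w -> t <= s / (2 * w) -> t * w < s.
  by move=> s0 w0; rewrite ler_pdivlMr ?mulr_gt0// => h; have := s0; lra.
have tr : t * (enorm v + 1) < r.
  by apply: small => //; rewrite ge_min lexx.
have tf : t * (enorm v + 1) < df.
  by apply: small => //; rewrite !ge_min lexx orbT.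
have tg : t * c < dg by apply: small => //; rewrite !ge_min lexx !orbT.
have tv : enorm (t *: v) = t * enorm v by rewrite enormZ gtr0_norm.
have tv1 : t * enorm v <= t * (enorm v + 1) by rewrite ler_pM2l// lerDl.
pose w := f (y + t *: v) - f y.
have wA : enorm (w - t *: v *m A) <= k * (t * enorm v).
  by rewrite -tv; apply: dfP; rewrite tv; lra.
have w_le : enorm w <= t * c.
  have := enorm_triangle w (t *: v *m A) 0; rewrite !subr0.
  have := aP (t *: v); rewrite tv => h1 h2.
  have h3 : k * (t * enorm v) <= 1 * (t * enorm v).
    by rewrite ler_wpM2r// mulr_ge0 ?enorm_ge0// ltW.
  have at0 : 0 <= a * t by rewrite mulr_ge0 ?ltW.
  by rewrite /c; lra.
have gw : enorm (t *: v - w *m B) <= k * enorm w.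
  have := dgP w (le_lt_trans w_le tg).
  rewrite /w subrKC !gf//; last first.
    by apply: rU; rewrite addrAC subrr add0r tv; lra.
  by rewrite [y + _]addrC addrK.
clearbody w.
have tE : t * enorm (v *m A *m B - v) <= t * e.
  rewrite -{1}(gtr0_norm t0) -enormZ scalerBr enormB.
  have -> : t *: v - t *: (v *m A *m B) =
      (t *: v - w *m B) + (w - t *: v *m A) *m B.
    by rewrite mulmxBl -!scalemxAl subrKA.
  rewrite (le_trans (enormD _ _))//.
  have h1 : b * enorm (w - t *: v *m A) <= b * (k * (t * enorm v)).
    by rewrite ler_pM2l.
  have h2 : k * enorm w <= k * (t * c) by rewrite ler_pM2l.
  have h3 := bP (w - t *: v *m A).
  have h4 : t * (k * (c + b * (enorm v + 1))) <= t * e by rewrite ler_pM2l.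
  have h5 : 0 <= b * k * t by rewrite !mulr_ge0// ltW.
  by lra.
by move: tE; rewrite ler_pM2l.
Qed.

End Frechet.

Section TangentCone.
Context {R : realType} {N : nat}.
Implicit Types (f g : 'rV[R]_N -> 'rV[R]_N) (h u v x y z : 'rV[R]_N).

(** The preimage of a coordinate subspace under an isomorphism has a basis of
    rows of the inverse matrix. *)
Lemma coordinate_subspace_preimage (q : nat) (A B : 'M[R]_N) :
    (q <= N)%N -> A *m B = 1%:M ->
  exists2 V : {vspace 'rV[R]_N}, \dim V = q &
    forall v, v \in V <-> (forall i : 'I_N, (q <= i)%N -> (v *m A) 0 i = 0).
Proof.
move=> qN AB; have BA : B *m A = 1%:M by exact: mulmx1C.
pose X := [tuple row (widen_ord qN i) B | i < q].
have Xi (i : 'I_q) : X`_i = row (widen_ord qN i) B.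
  by rewrite -tnth_nth tnth_mktuple.
have XA (i : 'I_q) (j : 'I_N) : (X`_i *m A) 0 j = (i == j :> nat)%:R.
  by rewrite Xi -row_mul BA !mxE -val_eqE.
have coordA (k : 'I_q -> R) (j : 'I_N) :
    ((\sum_(i < q) k i *: X`_i) *m A) 0 j = \sum_(i < q) k i * (i == j :> nat)%:R.
  rewrite mulmx_suml summxE; apply: eq_bigr => i _.
  by rewrite -scalemxAl mxE XA.
exists <<X>>%VS.
  have /eqP -> : free X; last by rewrite size_tuple.
  apply/freeP => k k0 i; have := coordA k (widen_ord qN i).
  rewrite k0 mul0mx mxE (bigD1 i)//= eqxx mulr1 big1 ?addr0// => j ji.
  by rewrite val_eqE (negbTE ji) mulr0.
move=> v; split=> [vX i qi|vA].
  rewrite (coord_span vX) coordA big1// => j _.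
  by rewrite ltn_eqF ?mulr0// (leq_trans (ltn_ord j)).
rewrite -[v]mulmx1 -AB mulmxA mulmx_sum_row memv_suml// => i _.
have [iq|qi] := ltnP i q; last by rewrite vA// scale0r mem0v.
rewrite memvZ// memv_span//; have -> : row i B = X`_(Ordinal iq).
  by rewrite Xi; congr (row _ B); exact: val_inj.
by rewrite mem_nth// size_tuple.
Qed.

(** At the centre of a straightening chart f with inverse g, the tangent cone
    consists of the vectors sent to R^q x 0 by the Jacobian of f. *)
Lemma ext_tangent_cone_submanifold (q : nat) (X M : set 'rV[R]_N) y (r : R) :
    submanifold_at q M y -> M y -> M `<=` X -> 0 < r ->
    (forall z, X z -> enorm (z - y) < r -> M z) ->
  exists2 V : {vspace 'rV[R]_N}, \dim V = q &
    ext_tangent_cone X y = [set v | v \in V].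
Proof.
move=> [qN [U [f [g [[oU Uy] ofU [smf smg] gf fUM]]]]] My MX r0 rM.
have fA := C1_frechet oU Uy smf.
have fUy : (f @` U) (f y) by exists y.
have gB := C1_frechet ofU fUy smg.
set A := \matrix_i _ in fA; set B := \matrix_i _ in gB.
have AB : A *m B = 1%:M := frechet_cancel oU Uy gf fA gB.
have [V dimV VA] := coordinate_subspace_preimage qN AB.
exists V => //; clearbody A B.
have flat z : U z -> M z -> forall i : 'I_N, (q <= i)%N -> f z 0 i = 0.
  move=> Uz Mz; have : (f @` (U `&` M)) (f z) by exists z.
  by rewrite fUM => -[].
have [dU dU0 dUP] := (nbhs_enorm _ _).1 (open_nbhs_nbhs (conj oU Uy)).
have [dF dF0 dFP] := (nbhs_enorm _ _).1 (open_nbhs_nbhs (conj ofU fUy)).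
apply/seteqP; split=> v /=.
- move=> Tv; apply/VA => i qi.
  have [a a0 aP] := mulmx_bounded A.
  apply/eqP; rewrite -normr_le0; apply/ler_addgt0Pr => e e0; rewrite add0r.
  have v1 : 0 < enorm v + 1 by rewrite ltr_wpDl ?enorm_ge0.
  have va : 0 < a + (enorm v + 1) by rewrite addr_gt0.
  pose k := Num.min 1 (e / (a + (enorm v + 1))).
  have k0 : 0 < k by rewrite lt_min ltr01 divr_gt0.
  have k1 : k <= 1 by rewrite ge_min lexx.
  have ke : k * (a + (enorm v + 1)) <= e.
    by rewrite -ler_pdivlMr// ge_min lexx orbT.
  clearbody k; have [d d0 dP] := fA k k0.
  pose s := Num.min k (Num.min (d / 2) (Num.min (r / 2) (dU / 2))).
  have s0 : 0 < s by rewrite !lt_min k0 !divr_gt0.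
  have sk : s <= k by rewrite ge_min lexx.
  have sd : s <= d / 2 by rewrite !ge_min lexx orbT.
  have sr : s <= r / 2 by rewrite !ge_min lexx !orbT.
  have sU : s <= dU / 2 by rewrite !ge_min lexx !orbT.
  clearbody s.
  have [x [xy Xx [_ [t /= t0 <-] tv]]] := Tv s s0.
  have {}xy : enorm (x - y) <= s by [].
  have Ux : U x by apply: dUP; lra.
  have Mx : M x by apply: rM => //; lra.
  have xd : enorm (x - y) < d by lra.
  have := dP _ xd; rewrite subrKC => dxy.
  have fx : `|((x - y) *m A) 0 i| <= k * enorm (x - y).
    apply: le_trans dxy; apply: le_trans (coord_le_enorm _ i).
    by rewrite !mxE (flat x)// (flat y)// subrr sub0r normrN.
  have tx : t * enorm (x - y) <= enorm v + 1.
    have := enorm_triangle (t *: (x - y)) v 0.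
    by rewrite !subr0 enormZ ger0_norm//; lra.
  have vE : (v *m A) 0 i = t * ((x - y) *m A) 0 i
      - ((t *: (x - y) - v) *m A) 0 i.
    by rewrite (mulmxBl (t *: (x - y))) -scalemxAl !mxE opprB addrC subrK.
  rewrite vE (le_trans (ler_normB _ _))// normrM (ger0_norm t0).
  have h1 : t * `|((x - y) *m A) 0 i| <= t * (k * enorm (x - y)).
    by rewrite ler_wpM2l.
  have h2 : k * (t * enorm (x - y)) <= k * (enorm v + 1).
    by rewrite ler_wpM2l// ltW.
  have h3 := coord_le_enorm ((t *: (x - y) - v) *m A) i.
  have h4 := aP (t *: (x - y) - v).
  have h5 : a * enorm (t *: (x - y) - v) <= a * k.
    by rewrite ler_pM2l// (le_trans tv).
  by lra.
- move=> /VA vA e e0; set w := v *m A.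
  have w1 : 0 < enorm w + 1 by rewrite ltr_wpDl ?enorm_ge0.
  have v1 : 0 < enorm v + e by rewrite ltr_wpDl ?enorm_ge0.
  have k0 : 0 < e / (enorm w + 1) by rewrite divr_gt0.
  set k := e / (enorm w + 1) in k0.
  have kw : k * enorm w <= e.
    by rewrite mulrAC ler_pdivrMr// ler_pM2l// lerDl.
  have [d d0 dP] := gB k k0.
  pose t := Num.min (d / (2 * (enorm w + 1)))
    (Num.min (dF / (2 * (enorm w + 1))) (e / (enorm v + e))).
  have t0 : 0 < t by rewrite !lt_min !divr_gt0// mulr_gt0.
  have td : t * (enorm w + 1) <= d / 2.
    by rewrite -ler_pdivlMr// -mulrA -invfM ge_min lexx.
  have tF : t * (enorm w + 1) <= dF / 2.
    by rewrite -ler_pdivlMr// -mulrA -invfM !ge_min lexx orbT.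
  have te : t * (enorm v + e) <= e.
    by rewrite -ler_pdivlMr// !ge_min lexx !orbT.
  clearbody t k.
  have tw : enorm (t *: w) = t * enorm w by rewrite enormZ gtr0_norm.
  have [x [Ux Mx] fx] : (f @` (U `&` M)) (f y + t *: w).
    rewrite fUM; split=> [|i qi /=].
      by apply: dFP; rewrite [f y + _]addrC addrK tw; lra.
    by rewrite mxE (flat y)// mxE vA// mulr0 addr0.
  have := dP (t *: w); rewrite tw -fx !gf// => dxy.
  have wB : w *m B = v by rewrite /w -mulmxA AB mulmx1.
  have {}dxy : enorm (x - y - t *: v) <= t * e.
    have := dxy _; rewrite -scalemxAl wB => h.
    have h1 : t * (k * enorm w) <= t * e by rewrite ler_pM2l.
    by apply: (le_trans (h _)); lra.
  exists x; split; [|exact: MX|].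
    have := enorm_triangle (x - y) (t *: v) 0.
    rewrite !subr0 [enorm (t *: v)]enormZ gtr0_norm// => h.
    by rewrite /eball/=; lra.
  exists (t^-1 *: (x - y)); first by exists t^-1 => //=; rewrite invr_ge0 ltW.
  have -> : t^-1 *: (x - y) - v = t^-1 *: (x - y - t *: v).
    by rewrite [RHS]scalerBr scalerA mulVf ?gt_eqF// scale1r.
  by rewrite enormZ gtr0_norm ?invr_gt0// mulrC ler_pdivrMr// mulrC.
Qed.

End TangentCone.

(** * Convergence of the stratifications *)

Section ExtendedLimits.
Context {R : realType}.
Local Open Scope ereal_scope.

Lemma cvg_to_0e (f : nat -> \bar R) : (forall n, 0 <= f n) ->
    (forall e : R, (0 < e)%R -> \forall n \near \oo, f n <= e%:E) ->
  f @ \oo --> 0.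
Proof.
move=> f0 fe; apply/fine_cvgP; split.
  near=> n; rewrite ge0_fin_numE// (@le_lt_trans _ _ 1%:E) ?ltry//.
  by near: n; exact: fe.
apply/cvgrPdist_le => e e0; near=> n.
have fne : f n <= e%:E by near: n; exact: fe.
have fn : f n \is a fin_num by rewrite ge0_fin_numE// (le_lt_trans fne) ?ltry.
by rewrite sub0r normrN ger0_norm ?fine_ge0// -lee_fin fineK.
Unshelve. all: by end_near. Qed.

Lemma cvg_to_0e_lt (f : nat -> \bar R) (e : R) : f @ \oo --> 0 -> (0 < e)%R ->
  \forall n \near \oo, f n < e%:E.
Proof.
move=> /fine_cvgP[ffin f0] e0; near=> n.
have fn : f n \is a fin_num by near: n.
rewrite -(fineK fn) lte_fin; near: n.
exact: (cvgr_lt (0 : R)%R).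
Unshelve. all: by end_near. Qed.

End ExtendedLimits.

Section Stratification.
Context {R : realType} {N : nat}.
Implicit Types (X K : set 'rV[R]_N) (p x y : 'rV[R]_N) (Phi : set 'rV[R]_N -> R).

Lemma dHd_ge0 X X' : (0 <= dHd X X')%E.
Proof. by apply: le_ereal_inf_tmp => _ [a [a0 _ _] <-]; rewrite lee_fin ltW. Qed.

Lemma thickeningS X (a b : R) : a <= b -> thickening X a `<=` thickening X b.
Proof. by move=> ab y [x Xx xy]; exists x => //; exact: le_trans ab. Qed.

Lemma dHd_lt X X' (a : R) : (dHd X X' < a%:E)%E ->
  X `<=` thickening X' a /\ X' `<=` thickening X a.
Proof.
move=> /ereal_inf_lt[_ [b [b0 XX' X'X] <-]]; rewrite lte_fin => /ltW ba.
by split=> x Xx; apply: thickeningS ba _ _; [exact: XX' | exact: X'X].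
Qed.

Lemma zoom_approxS X (h h' z : R) p x0 X' : 0 < h -> h <= h' ->
  zoom_approx X h z p x0 X' -> zoom_approx X h' z p x0 X'.
Proof.
move=> h0 hh' [hz x0p X'X XX'].
have h'0 : 0 < h' := lt_le_trans h0 hh'.
have z0 : 0 < z by apply: lt_trans hz; rewrite invr_gt0.
have hz' : h / z <= h' / z by rewrite ler_wpM2r// invr_ge0 ltW.
split.
- by apply: le_lt_trans hz; rewrite lef_pV2.
- exact: le_trans hz'.
- by move=> x /X'X; exact: thickeningS.
- by move=> x /XX'; exact: thickeningS.
Qed.

(** Compactness of K makes the comparison of the magnifications with the
    tangent cones uniform; the accuracy 1 / (k + 1) and the property Q k of
    the values of Phi share the index k, so that Q may be relaxed with it. *)
Lemma Phi_magnification_uniform X K Phi (Q : nat -> R -> Prop) :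
    samstar_continuous Phi -> compact K -> K `<=` X -> uniformly_conic X K ->
    (forall y, K y -> exists e : R, exists n : nat, 0 < e /\
      forall k s, (n <= k)%N -> `|Phi (ext_tangent_cone X y) - s| < e -> Q k s) ->
  exists k, forall p, K p -> forall (z : R) x0 X',
    zoom_approx X k.+1%:R^-1 z p x0 X' -> Q k (Phi (magnification z x0 X')).
Proof.
move=> Phic cK KX conic KQ.
have near_cover : near_covering_within K.
  exact/near_covering_withinP/compact_near_coveringP.
have [|m _ /(_ m (leqnn m)) mP] := near_cover nat \oo (fun k p =>
    forall (z : R) x0 X', zoom_approx X k.+1%:R^-1 z p x0 X' ->
      Q k (Phi (magnification z x0 X'))) _; last by exists m.
move=> y Ky; have [e [n [e0 nQ]]] := KQ y Ky.
have [d d0 dP] := Phic (ext_tangent_cone X y) e e0.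
have d20 : 0 < d / 2 by rewrite divr_gt0.
have [h h0 hP] := magnification_near_cone conic KX Ky d20.
have [m mh] : exists m : nat, h^-1 < m%:R.
  by exists (Num.bound h^-1); rewrite archi_boundP// invr_ge0 ltW.
exists ([set p | enorm (p - y) < h], [set k | (maxn n m <= k)%N]).
  split=> /=; first by apply/nbhs_enorm; exists h.
  by exists (maxn n m).
move=> [p k] [/= py]; rewrite geq_max => /andP[nk mk] Kp z x0 X' zoom.
apply: nQ nk _; apply: dP.
rewrite (@le_lt_trans _ _ (d / 2)%:E) ?lte_fin//; last by lra.
apply: (hP p) => //; apply: zoom_approxS zoom; first by rewrite invr_gt0.
rewrite invf_ple ?posrE// (le_trans (ltW mh))// ler_nat.
exact: leq_trans mk _.
Qed.

Lemma dSamP_le (S S' : SamP R N) (e : R) :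
  (dHd (samP_total S) (samP_total S') <= e%:E)%E ->
  (dHd (samP_p S) (samP_p S') <= e%:E)%E -> (dSamP S S' <= e%:E)%E.
Proof. by rewrite ge_max => -> ->. Qed.

Lemma closed_away (K : set 'rV[R]_N) (e : R) :
  closed [set y | forall p, K p -> e <= enorm (y - p)].
Proof.
move=> y cly p Kp; rewrite leNgt; apply/negP => yp.
have : nbhs y [set z | enorm (z - p) < e].
  apply/nbhs_enorm; exists (e - enorm (y - p)) => [|z zy /=]; first by rewrite subr_gt0.
  by rewrite (le_lt_trans (enorm_triangle _ y _))// -ltrBrDr.
by move=> /cly[z [/= Kz zp]]; have := Kz p Kp; rewrite leNgt zp.
Qed.

End Stratification.

Theorem mainTheorem1 (R : realType) (N q : nat)
    (X : set 'rV[R]_N) (s : 'rV[R]_N -> bool) (Phi : set 'rV[R]_N -> R)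
    (Phi01 : forall B : set 'rV[R]_N, 0 <= Phi B <= 1)
    (Phi_cont : samstar_continuous Phi)
    (Phi_subspace : forall V : {vspace 'rV[R]_N},
       \dim V = q -> Phi [set v : 'rV[R]_N | v \in V] = 1)
    (X_compact : compact X)
    (W_LW : lojasiewicz_whitney q X s)
    (W_Phi : Phi_stratified Phi X s) :
  exists u0 : R, 0 < u0 < 1 /\
    forall u : R, u0 <= u < 1 ->
    forall (zeta : nat -> R) (Xn : nat -> set 'rV[R]_N),
      (forall n, 0 < zeta n) ->
      zeta @ \oo --> +oo ->
      (fun n => ((zeta n)%:E * dHd (Xn n) X)%E) @ \oo --> 0%E ->
      (fun n => dSamP (Phi_stratification Phi u (zeta n) (Xn n))
                      (samP_of_strat X s))
        @ \oo --> 0%E.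
Proof.
set Wp := stratum X s false.
have [[strat _ _ [_ Wq_dim] _] _] := W_LW.
have cWp : compact Wp.
  have [|C cC XC] := strat [set false]; first by move=> [] [] //= _ [].
  by rewrite /Wp/stratum XC; exact: compact_closedI.
have WpX : Wp `<=` X by move=> p [].
have Wp_conic : uniformly_conic X Wp.
  exact: lojasiewicz_uniformly_conic X_compact W_LW cWp (@subset_refl _ _).
(* W_p is compact, so the value of Phi at magnifications close to it stays
   below some u0 < 1. *)
have [k0 k0P] : exists k, forall p, Wp p -> forall (z : R) x0 X',
    zoom_approx X k.+1%:R^-1 z p x0 X' ->
    Phi (magnification z x0 X') <= 1 - k.+2%:R^-1.
  apply: (Phi_magnification_uniform (Q := fun k t => t <= 1 - k.+2%:R^-1))
    Phi_cont cWp WpX Wp_conic _ => p Wpp.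
  pose e := (1 - Phi (ext_tangent_cone X p)) / 2.
  have e0 : 0 < e by rewrite divr_gt0// subr_gt0; exact: W_Phi.
  exists e, (Num.bound e^-1); split=> // k t ek.
  rewrite ltr_norml => /andP[lo _].
  have ke : k.+2%:R^-1 <= e.
    rewrite invf_ple ?posrE//.
    rewrite (le_trans (ltW (archi_boundP _))) ?invr_ge0 ?(ltW e0)//.
    by rewrite ler_nat (leq_trans ek)// -addn2 leq_addr.
  rewrite lerBrDr (le_trans (lerD (lexx t) ke))//.
  by rewrite /e in lo *; lra.
have k2 : 0 < (k0.+2%:R^-1 : R) < 1 by rewrite invr_gt0 invf_lt1// ltr1n ltr0n.
exists (1 - k0.+2%:R^-1); split; first by rewrite subr_gt0 ltrBlDr ltrDl andbC.
move=> u /andP[u0u u1] zeta Xn zeta0 zetaoo dXn.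
apply: cvg_to_0e => [n|e e0].
  by rewrite /dSamP le_max dHd_ge0.
(* Away from the singular stratum, all tangent cones are subspaces, and there
   Phi is eventually larger than u. *)
pose K := X `&` [set y | forall p, Wp p -> e / 2 <= enorm (y - p)].
have cK : compact K by apply: compact_closedI => //; exact: closed_away.
have e20 : 0 < e / 2 by rewrite divr_gt0.
have KX : K `<=` X by move=> y [].
have far_q y z : K y -> X z -> enorm (z - y) < e / 2 -> stratum X s true z.
  move=> [_ /= Ky] Xz zy; split=> //=; case sz: (s z) => //.
  have /Ky : Wp z by split.
  by rewrite enormB leNgt zy.
have Kq : K `<=` stratum X s true.
  by move=> y Ky; apply: (far_q y) => //; [exact: KX | rewrite subrr enorm0].
have K_conic := lojasiewicz_uniformly_conic X_compact W_LW cK Kq.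
have [k1 k1P] : exists k, forall p, K p -> forall (z : R) x0 X',
    zoom_approx X k.+1%:R^-1 z p x0 X' -> u < Phi (magnification z x0 X').
  apply: (Phi_magnification_uniform (Q := fun _ t => u < t))
    Phi_cont cK KX K_conic _ => y Ky.
  exists (1 - u), 0%N; rewrite subr_gt0; split=> // _ t _.
  have [V dimV ->] := ext_tangent_cone_submanifold (Wq_dim y (Kq y Ky)) (Kq y Ky)
    (@subIsetl _ _ _) e20 (far_q y ^~ Ky).
  by rewrite Phi_subspace// ltr_norml => /andP[_]; lra.
pose h : R := Num.min k0.+1%:R^-1 k1.+1%:R^-1.
have h0 : 0 < h by rewrite lt_min !invr_gt0 !ltr0n.
near=> n.
have zn : 2 / e < zeta n by near: n; move/cvgryPgt: zetaoo; apply.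
have hz : h^-1 < zeta n by near: n; move/cvgryPgt: zetaoo; apply.
have z0 := zeta0 n.
have /dHd_lt[XnX XXn] : (dHd (Xn n) X < (h / zeta n)%:E)%E.
  rewrite EFinM muleC lte_pdivlMl//; near: n.
  exact: cvg_to_0e_lt.
have hze : h / zeta n <= e / 2.
  have h1 : h <= 1 by rewrite ge_min invf_le1 ?ltr0n// ler1n.
  have ez : 2 <= zeta n * e by rewrite -ler_pdivrMr// ltW.
  rewrite ler_pdivrMr// (le_trans h1)// mulrAC ler_pdivlMr// mul1r.
  by rewrite mulrC.
have near_dHd A B : A `<=` thickening B e -> B `<=` thickening A e ->
  (dHd A B <= e%:E)%E.
  by move=> AB BA; apply: ereal_inf_lbound; exists e.
apply: dSamP_le; apply: near_dHd.
- by move=> x /XnX; apply: thickeningS; lra.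
- by move=> x /XXn; apply: thickeningS; lra.
- move=> x0 [Xx0 /= Phix0]; have [y Xy yx0] := XnX x0 Xx0.
  apply: contrapT => far.
  have Ky : K y.
    split=> // p Wpp; rewrite leNgt; apply/negP => yp.
    apply: far; exists p => //; rewrite (le_trans (enorm_triangle _ y _))//.
    by rewrite enormB; lra.
  have : u < Phi (magnification (zeta n) x0 (Xn n)).
    apply: (k1P y Ky); apply: (@zoom_approxS _ _ _ h) => //.
      by rewrite ge_min lexx orbT.
    by split=> //; rewrite enormB.
  by rewrite ltNge Phix0.
- move=> p Wpp; have [x0 Xx0 x0p] := XXn p (WpX p Wpp).
  exists x0; last by lra.
  split=> //=; apply: le_trans u0u; apply: (k0P p Wpp).
  by apply: (@zoom_approxS _ _ _ h) => //; rewrite ge_min lexx.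
Unshelve. all: by end_near. Qed.
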